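(* Let $A$ be a basic Brauer tree algebra with multiplicity one over an algebraically closed field $K$. Let $T_i$ be the (minimal) projective presentation of an indecomposable nonprojective $A$-module, let $P$ be a stalk complex of an indecomposable projective module concentrated in degree $0$, and let $T_i\oplus P$ be a partial tilting complex. Then $\mathrm{Hom}_{K^b(A)}(T_i,P)\neq 0$ if and only if a degree one source of $T_i$ and the vertex corresponding to $P$ belong to the same $A$-cycle and this source is the only vertex of $T_i$ belonging to this $A$-cycle.
   Context: Algebras. Modules are finitely generated left modules; in a path algebra $ab$ means first $a$, then $b$. $K^b(A)$ is the bounded homotopy category of $A$-modules. Let $\Gamma$ be a finite tree with $n$ edges and a fixed cyclic ordering of the edges incident to each vertex. The Brauer quiver $Q_\Gamma$ has the edges of $\Gamma$ as vertices; for each vertex $v$ of $\Gamma$ and each edge $i$ incident to $v$ there is an arrow $i\to j$, where $j$ follows $i$ in the cyclic order at $v$ (a loop if $i$ is the only edge at $v$). So $Q_\Gamma$ is the union of oriented cycles, one for each vertex of $\Gamma$, and every vertex of $Q_\Gamma$ lies on exactly two of them. The arrows are divided into two families $\alpha$ and $\beta$ so that arrows of intersecting cycles are in different families. The basic Brauer tree algebra with multiplicity one of $\Gamma$ is $A=KQ_\Gamma/I$, with $I$ generated by $\alpha\beta=0=\beta\alpha$ and, for each vertex $x$, $\alpha^{x_\alpha}=\beta^{x_\beta}$, where $x_\alpha$ (resp. $x_\beta$) is the length of the $\alpha$-cycle (resp. $\beta$-cycle) through $x$. An $A$-cycle is a maximal ordered set of nonrepeating arrows such that the product of any two neighboring ones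 is nonzero; the $A$-cycles are the oriented cycles attached to the vertices of $\Gamma$ (including formal loops), so every vertex of the quiver lies on exactly two $A$-cycles. For a vertex $x$, $Ae_x$ is the corresponding indecomposable projective; $x$ is called the vertex corresponding to $Ae_x$. Complexes. A perfect complex $T$ (bounded, of finitely generated projectives) is partial tilting if $\mathrm{Hom}_{D^b(A)}(T,T[i])=0$ for all $i\ne0$. A minimal projective presentation $P_0\xrightarrow{f}P_1$ is viewed as a complex with $P_0$ in degree $0$ and $P_1$ in degree $1$. (Known: the minimal projective presentation of an indecomposable non-projective module $M$ is partial tilting iff $M$ is not isomorphic to $P/\mathrm{soc}(P)$ for any indecomposable projective $P$.) Diagrams. Let $T=(P_0\xrightarrow{f}P_1)$ be the minimal projective presentation of an indecomposable non-projective module not of the form $P/\mathrm{soc}(P)$, $P_0=\bigoplus_{i\in I}Ae_i$, $P_1=\bigoplus_{i\in J}Ae_i$. (Each index occurs only once and in only one of $I,J$.) The diagram of $T$, also denoted $T$, is obtained by marking on the quiver the vertices in $I\cup J$ and the directed path (inside one $A$-cycle) from $i\in I$ to $j\in J$ whenever $f$ has a nonzero component $Ae_i\to Ae_j$. It is a connected path without self-intersections, with more than one vertex, which changes orientation and $A$-cycle exactly at the vertices of $I\cup J$; its sources are the elements of $I$, its sinks are the elements of $J$. The vertices of $T$ are all vertices on this path. A vertex of the diagram has degree one if it is an end point of the path. *)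

(* Defs.v *)
From HB Require Import structures.
From mathcomp Require Import all_boot all_order all_algebra finmap.
From mathcomp.classical Require Import boolp.
From mathcomp.multinomials Require Import monalg.

Set Implicit Arguments.
Unset Strict Implicit.
Unset Printing Implicit Defensive.

Import GRing.Theory.
Local Open Scope ring_scope.

Record quiver := Quiver {
  qvert : finType;
  qarrow : finType;
  qsrc : qarrow -> qvert;
  qtgt : qarrow -> qvert }.

Section Paths.
Variable Q : quiver.

Fixpoint walk (x : qvert Q) (l : seq (qarrow Q)) : bool :=
  if l is a :: l' then (qsrc a == x) && walk (qtgt a) l' else true.

Definition walk_end (x : qvert Q) (l : seq (qarrow Q)) : qvert Q :=
  last x (map (@qtgt Q) l).

Definition qpath := {p : qvert Q * seq (qarrow Q) | walk p.1 p.2}.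
HB.instance Definition _ := SubChoice.on qpath.

Definition psrc (p : qpath) : qvert Q := (val p).1.
Definition pend (p : qpath) : qvert Q := walk_end (val p).1 (val p).2.

Definition trivial_path (x : qvert Q) : qpath := exist _ (x, [::]) isT.

Lemma walk_arrow (a : qarrow Q) : walk (qsrc a) [:: a].
Proof. by rewrite /= eqxx. Qed.

Definition arrow_path (a : qarrow Q) : qpath :=
  exist (fun p => walk p.1 p.2) (qsrc a, [:: a]) (walk_arrow a).

(* First [p], then [q].  [insub] never fails when the endpoints match. *)
Definition pcat (p q : qpath) : option qpath :=
  if pend p == psrc q 
  then insub ((val p).1, (val p).2 ++ (val q).2) : option qpath else None.

Lemma walk_cat x l1 l2 :
  walk x (l1 ++ l2) = walk x l1 && walk (walk_end x l1) l2.
Proof. by elim: l1 x => //= a l IH x; rewrite IH andbA. Qed.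

Lemma walk_end_cat x l1 l2 :
  walk_end x (l1 ++ l2) = walk_end (walk_end x l1) l2.
Proof. by rewrite /walk_end map_cat last_cat. Qed.

Lemma pcat_some p q r : pcat p q = Some r ->
  pend p = psrc q /\ val r = ((val p).1, (val p).2 ++ (val q).2).
Proof. by rewrite /pcat; case: eqP => // -> ; case: insubP => //= u _ <- [<-]. Qed.

Lemma pcatE p q : pend p = psrc q ->
  exists2 r, pcat p q = Some r & val r = ((val p).1, (val p).2 ++ (val q).2).
Proof.
move=> e; rewrite /pcat e eqxx; case: insubP => [u _ <-|]; first by exists u.
rewrite /= walk_cat (valP p) /=; move: e; rewrite /pend => ->.
by rewrite (valP q).
Qed.

Lemma pcat_none p q : pend p <> psrc q -> pcat p q = None.
Proof. by rewrite /pcat => /eqP/negbTE ->. Qed.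

Lemma pcatA p q r :
  obind (pcat p) (pcat q r) = obind (fun s => pcat s r) (pcat p q).
Proof.
case: (pend q =P psrc r) => eqr; case: (pend p =P psrc q) => epq.
- have [s -> vs] := pcatE eqr; have [t -> vt] := pcatE epq; rewrite /=.
  have [|u -> vu] := @pcatE p s; first by rewrite /psrc vs.
  have [|w -> vw] := @pcatE t r.
    rewrite /pend vt /= walk_end_cat; move: epq; rewrite /pend => ->.
    by move: eqr; rewrite /pend.
  by congr Some; apply: val_inj; rewrite vu vw vs vt /= catA.
- have [s -> vs] := pcatE eqr; rewrite (pcat_none epq) /= pcat_none //.
  by rewrite /psrc vs.
- have [t -> vt] := pcatE epq; rewrite (pcat_none eqr) /= pcat_none //.
  rewrite /pend vt /= walk_end_cat; move: epq; rewrite /pend => ->.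
  by move: eqr; rewrite /pend.
- by rewrite !pcat_none.
Qed.

Lemma pcat1p x p : pcat (trivial_path x) p = if x == psrc p then Some p else None.
Proof.
case: eqP => [e|ne]; last by rewrite pcat_none.
have [r -> vr] := @pcatE (trivial_path x) p e; congr Some; apply: val_inj.
by rewrite vr /= e /psrc; case: p {e r vr} => -[].
Qed.

Lemma pcatp1 x p : pcat p (trivial_path x) = if x == pend p then Some p else None.
Proof.
case: eqP => [e|ne]; last by rewrite pcat_none // => e; case: ne.
have [r -> vr] := @pcatE p (trivial_path x) (esym e).
by congr Some; apply: val_inj; rewrite vr /= cats0; case: p {e r vr} => -[].
Qed.

End Paths.

Section BilinearExtension.
Variables (K : pzRingType) (V : lmodType K) (T : Type) (U : T -> V).
Variable genU : forall P : V -> Prop,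
  P 0 -> (forall x y, P x -> P y -> P (x + y)) -> (forall c p, P (c *: U p)) ->
  forall x, P x.

Lemma bilinear_assoc (mul : V -> V -> V) :
  left_zero 0 mul -> right_zero 0 mul ->
  left_distributive mul +%R -> right_distributive mul +%R ->
  (forall c x y, mul (c *: x) y = c *: mul x y) ->
  (forall c x y, mul x (c *: y) = c *: mul x y) ->
  (forall p q r, mul (U p) (mul (U q) (U r)) = mul (mul (U p) (U q)) (U r)) ->
  associative mul.
Proof.
move=> m0l m0r mDl mDr mZl mZr mU x y z.
elim/genU: x => [|? ? IH1 IH2|c p]; first by rewrite !m0l.
  by rewrite !mDl IH1 IH2.
rewrite !mZl; congr (_ *: _); elim/genU: y => [|? ? IH1 IH2|{}c q].
- by rewrite !(m0l, m0r).
- by rewrite !(mDl, mDr) IH1 IH2.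
rewrite !(mZl, mZr, mZl); congr (_ *: _); elim/genU: z => [|? ? IH1 IH2|{}c r].
- by rewrite !m0r.
- by rewrite !mDr IH1 IH2.
by rewrite !mZr mU.
Qed.

Lemma bilinear_id (op : V -> V) :
  op 0 = 0 -> {morph op : x y / x + y} -> (forall c x, op (c *: x) = c *: op x) ->
  (forall p, op (U p) = U p) -> op =1 id.
Proof.
move=> o0 oD oZ oU; elim/genU => [|x y ex ey|c p]; first exact: o0.
  by rewrite oD ex ey.
by rewrite oZ oU.
Qed.

End BilinearExtension.

Section PathAlgebra.
Variables (K : fieldType) (Q : quiver).

Local Notation combs := {malg K[qpath Q]}.

Local Open Scope fset_scope.
Implicit Types (x y z : combs) (p q r : qpath Q).
Local Open Scope ring_scope.

(* Locked: conversion on concrete finitely supported functions is slow. *)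
Fact path_key : unit. Proof. exact: tt. Qed.

Definition pathU : qpath Q -> combs := locked_with path_key (fun p => mkmalgU p 1).

Lemma pathUE p : pathU p = mkmalgU p 1.
Proof. by rewrite /pathU unlock. Qed.

Definition opathU (o : option (qpath Q)) : combs :=
  if o is Some p then pathU p else 0.

Definition path_one : combs := \sum_(v : qvert Q) pathU (trivial_path v).

Definition path_mul : combs -> combs -> combs :=
  locked_with path_key (fun x y =>
    \sum_(p <- msupp x) \sum_(q <- msupp y)
       (mcoeff p x * mcoeff q y) *: opathU (pcat p q)).

Lemma path_mulE x y : path_mul x y =
  \sum_(p <- msupp x) \sum_(q <- msupp y)
     (mcoeff p x * mcoeff q y) *: opathU (pcat p q).
Proof. by rewrite /path_mul unlock. Qed.

Lemma path_algE x : x = \sum_(p <- msupp x) mcoeff p x *: pathU p.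
Proof.
rewrite {1}[x]monalgE; apply: eq_bigr => p _; apply/malgP => q.
rewrite pathUE mcoeffZ [LHS]mcoeffU [X in _ = _ * X]mcoeffU.
by case: (p == q); rewrite ?mulr1 ?mulr0.
Qed.

Lemma path_alg_ind (P : combs -> Prop) :
    P 0 -> (forall x y, P x -> P y -> P (x + y)) ->
    (forall c p, P (c *: pathU p)) ->
  forall x, P x.
Proof. by move=> P0 PD PU x; rewrite [x]path_algE; elim/big_ind: _. Qed.

Lemma path_mulw (d1 d2 : {fset qpath Q}) x y :
  msupp x `<=` d1 -> msupp y `<=` d2 ->
  path_mul x y = \sum_(p <- d1) \sum_(q <- d2)
     (mcoeff p x * mcoeff q y) *: opathU (pcat p q).
Proof.
move=> le1 le2; rewrite path_mulE (big_fset_incl _ le1) /=.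
  apply: eq_bigr => p _; apply: big_fset_incl => // q _ /mcoeff_outdom ->.
  by rewrite mulr0 scale0r.
move=> p _ /mcoeff_outdom ->; rewrite big1 // => q _.
by rewrite mul0r scale0r.
Qed.

Fact path_mulDl : left_distributive path_mul +%R.
Proof.
move=> x y z; set d := msupp x `|` msupp y.
rewrite (@path_mulw d (msupp z)) ?msuppD_le //.
rewrite (@path_mulw d (msupp z) x) ?fsubsetUl //.
rewrite (@path_mulw d (msupp z) y) ?fsubsetUr //.
rewrite -big_split; apply: eq_bigr => p _; rewrite -big_split.
by apply: eq_bigr => q _; rewrite mcoeffD mulrDl scalerDl.
Qed.

Fact path_mulDr : right_distributive path_mul +%R.
Proof.
move=> x y z; set d := msupp y `|` msupp z.
rewrite (@path_mulw (msupp x) d) ?msuppD_le //.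
rewrite (@path_mulw (msupp x) d x y) ?fsubsetUl //.
rewrite (@path_mulw (msupp x) d x z) ?fsubsetUr //.
rewrite -big_split; apply: eq_bigr => p _; rewrite -big_split.
by apply: eq_bigr => q _; rewrite mcoeffD mulrDr scalerDl.
Qed.

Fact path_mul0l : left_zero 0 path_mul.
Proof. by move=> x; rewrite path_mulE msupp0 big_seq_fset0. Qed.

Fact path_mul0r : right_zero 0 path_mul.
Proof.
by move=> x; rewrite path_mulE big1 // => p _; rewrite msupp0 big_seq_fset0.
Qed.

Lemma path_mulZl c x y : path_mul (c *: x) y = c *: path_mul x y.
Proof.
rewrite (@path_mulw (msupp x) (msupp y)) ?msuppZ_le // path_mulE scaler_sumr.
apply: eq_bigr => p _; rewrite scaler_sumr; apply: eq_bigr => q _.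
by rewrite mcoeffZ scalerA mulrA.
Qed.

Lemma path_mulZr c x y : path_mul x (c *: y) = c *: path_mul x y.
Proof.
rewrite (@path_mulw (msupp x) (msupp y)) ?msuppZ_le // path_mulE scaler_sumr.
apply: eq_bigr => p _; rewrite scaler_sumr; apply: eq_bigr => q _.
by rewrite mcoeffZ scalerA mulrCA.
Qed.

Lemma path_mul_suml I (s : seq I) (F : I -> combs) y :
  path_mul (\sum_(i <- s) F i) y = \sum_(i <- s) path_mul (F i) y.
Proof.
by elim: s => [|i s IH]; rewrite ?big_nil ?path_mul0l // !big_cons path_mulDl IH.
Qed.

Lemma path_mul_sumr I (s : seq I) (F : I -> combs) x :
  path_mul x (\sum_(i <- s) F i) = \sum_(i <- s) path_mul x (F i).
Proof.
by elim: s => [|i s IH]; rewrite ?big_nil ?path_mul0r // !big_cons path_mulDr IH.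
Qed.

Lemma path_mulUU p q : path_mul (pathU p) (pathU q) = opathU (pcat p q).
Proof.
rewrite !pathUE (@path_mulw [fset p]%fset [fset q]%fset) ?msuppU_le //.
by rewrite !big_seq_fset1 !mcoeffUU mulr1 scale1r.
Qed.

Fact path_mulA : associative path_mul.
Proof.
apply: (bilinear_assoc path_alg_ind path_mul0l path_mul0r path_mulDl path_mulDr
          path_mulZl path_mulZr) => p q r.
rewrite [path_mul (pathU q) _]path_mulUU [path_mul (pathU p) (pathU q)]path_mulUU.
have := pcatA p q r; case: (pcat q r) => [s|]; case: (pcat p q) => [t|] /= E.
- by rewrite [LHS]path_mulUU [RHS]path_mulUU E.
- by rewrite [LHS]path_mulUU [RHS]path_mul0l E.
- by rewrite [LHS]path_mul0r [RHS]path_mulUU -E.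
- by rewrite [LHS]path_mul0r [RHS]path_mul0l.
Qed.

Fact path_mul1l : left_id path_one path_mul.
Proof.
apply: (bilinear_id path_alg_ind (op := path_mul path_one) (path_mul0r _)
          (path_mulDr _) (fun c => path_mulZr c _)) => p.
rewrite [LHS]path_mul_suml (bigD1 (psrc p)) //= [X in _ + X]big1 => [|v ne].
  by rewrite [X in X + _]path_mulUU pcat1p eqxx addr0.
by rewrite [LHS]path_mulUU pcat1p (negbTE ne).
Qed.

Fact path_mul1r : right_id path_one path_mul.
Proof.
apply: (bilinear_id path_alg_ind (op := path_mul^~ path_one) (path_mul0l _)
          (fun x y => path_mulDl x y _) (fun c x => path_mulZl c x _)) => p.
rewrite [LHS]path_mul_sumr (bigD1 (pend p)) //= [X in _ + X]big1 => [|v ne].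
  by rewrite [X in X + _]path_mulUU pcatp1 eqxx addr0.
by rewrite [LHS]path_mulUU pcatp1 (negbTE ne).
Qed.

Definition path_alg := combs.
HB.instance Definition _ := GRing.Lmodule.on path_alg.
HB.instance Definition _ := GRing.Zmodule_isPzRing.Build path_alg
  path_mulA path_mul1l path_mul1r path_mulDl path_mulDr.

Lemma pathUM p q : (pathU p : path_alg) * pathU q = opathU (pcat p q).
Proof. exact: path_mulUU. Qed.

End PathAlgebra.

Section RingQuotient.
Variables (R : pzRingType) (rel : R -> Prop).

Definition in_ideal (x : R) : Prop :=
  exists (n : nat) (a r b : 'I_n -> R),
    (forall k, rel (r k)) /\ x = \sum_(k < n) a k * r k * b k.

Definition ideal_gen : {pred R} := fun x => `[< in_ideal x >].

Lemma ideal_genD x y : in_ideal x -> in_ideal y -> in_ideal (x + y).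
Proof.
move=> [n [a [r [b [hr ->]]]]] [m [a' [r' [b' [hr' ->]]]]].
pose glue (u : 'I_n -> R) (v : 'I_m -> R) (k : 'I_(n + m)) :=
  match split k with inl i => u i | inr j => v j end.
exists (n + m)%N, (glue a a'), (glue r r'), (glue b b'); split.
  by move=> k; rewrite /glue; case: split.
rewrite big_split_ord /=; congr (_ + _); apply: eq_bigr => k _; rewrite /glue.
  by rewrite (unsplitK (inl k : 'I_n + 'I_m)).
by rewrite (unsplitK (inr k : 'I_n + 'I_m)).
Qed.

Lemma ideal_genMl c x : in_ideal x -> in_ideal (c * x).
Proof.
move=> [n [a [r [b [hr ->]]]]]; exists n, (fun k => c * a k), r, b; split=> //.
by rewrite mulr_sumr; apply: eq_bigr => k _; rewrite !mulrA.
Qed.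

Lemma ideal_genMr c x : in_ideal x -> in_ideal (x * c).
Proof.
move=> [n [a [r [b [hr ->]]]]]; exists n, a, r, (fun k => b k * c); split=> //.
by rewrite mulr_suml; apply: eq_bigr => k _; rewrite !mulrA.
Qed.

Fact ideal_gen_zmod : zmod_closed ideal_gen.
Proof.
split=> [|x y /asboolP hx /asboolP hy]; apply/asboolP.
  by exists 0%N, (fun=> 0), (fun=> 0), (fun=> 0); split=> [[]//|]; rewrite big_ord0.
by apply: ideal_genD => //; rewrite -mulN1r; apply: ideal_genMl.
Qed.
HB.instance Definition _ := GRing.isZmodClosed.Build R ideal_gen ideal_gen_zmod.

Definition ring_quot := Quotient.quot ideal_gen.
HB.instance Definition _ := GRing.Zmodule.on ring_quot.

Local Open Scope quotient_scope.

Definition quot_pi (x : R) : ring_quot := \pi_(Quotient.quot ideal_gen) x.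

Lemma quot_piP x y : quot_pi x = quot_pi y <-> in_ideal (x - y).
Proof.
rewrite (rwP eqP) /quot_pi -Quotient.idealrBE.
by split=> [/asboolP|h]; last apply/asboolP.
Qed.

Lemma quot_pi_repr (u : ring_quot) : quot_pi (repr u) = u.
Proof. exact: reprK. Qed.

Lemma quot_piD x y : quot_pi (x + y) = quot_pi x + quot_pi y.
Proof. exact: Quotient.pi_add. Qed.

Definition quot_one : ring_quot := quot_pi 1.
Definition quot_mul (u v : ring_quot) : ring_quot := quot_pi (repr u * repr v).

Lemma quot_pi_mul x y : quot_pi (x * y) = quot_mul (quot_pi x) (quot_pi y).
Proof.
apply/quot_piP; set x' := repr _; set y' := repr _.
have hx : in_ideal (x - x') by apply/quot_piP; rewrite quot_pi_repr.
have hy : in_ideal (y - y') by apply/quot_piP; rewrite quot_pi_repr.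
have -> : x * y - x' * y' = (x - x') * y + x' * (y - y').
  by rewrite mulrBl mulrBr addrA addrNK.
by apply: ideal_genD; [apply: ideal_genMr | apply: ideal_genMl].
Qed.

Fact quot_mulA : associative quot_mul.
Proof.
move=> u v w; rewrite -[u]quot_pi_repr -[v]quot_pi_repr -[w]quot_pi_repr.
by rewrite -!quot_pi_mul mulrA.
Qed.
Fact quot_mul1l : left_id quot_one quot_mul.
Proof. by move=> u; rewrite -[u]quot_pi_repr -quot_pi_mul mul1r. Qed.
Fact quot_mul1r : right_id quot_one quot_mul.
Proof. by move=> u; rewrite -[u]quot_pi_repr -quot_pi_mul mulr1. Qed.
Fact quot_mulDl : left_distributive quot_mul +%R.
Proof.
move=> u v w; rewrite -[u]quot_pi_repr -[v]quot_pi_repr -[w]quot_pi_repr.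
by rewrite -quot_piD -!quot_pi_mul -quot_piD mulrDl.
Qed.
Fact quot_mulDr : right_distributive quot_mul +%R.
Proof.
move=> u v w; rewrite -[u]quot_pi_repr -[v]quot_pi_repr -[w]quot_pi_repr.
by rewrite -quot_piD -!quot_pi_mul -quot_piD mulrDr.
Qed.

HB.instance Definition _ := GRing.Zmodule_isPzRing.Build ring_quot
  quot_mulA quot_mul1l quot_mul1r quot_mulDl quot_mulDr.

Lemma quot_piM x y : quot_pi (x * y) = quot_pi x * quot_pi y.
Proof. exact: quot_pi_mul. Qed.

End RingQuotient.

Definition surjective (X Y : Type) (f : X -> Y) : Prop := forall y, exists x, f x = y.

Section Modules.
Variable R : pzRingType.
Implicit Types M N P : lmodType R.

Definition fin_gen M : Prop :=
  exists (n : nat) (g : 'I_n -> M),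
    forall x, exists c : 'I_n -> R, x = \sum_(k < n) c k *: g k.

Definition zero_module M : Prop := forall x : M, x = 0.

Definition isomorphic M N : Prop := exists f : {linear M -> N}, bijective f.

Definition indecomposable M : Prop :=
  ~ zero_module M /\
  forall N1 N2 : lmodType R,
    isomorphic M (N1 * N2)%type -> zero_module N1 \/ zero_module N2.

Definition projective P : Prop :=
  forall (X Y : lmodType R) (g : {linear X -> Y}) (f : {linear P -> Y}),
    surjective g -> exists h : {linear P -> X}, forall x, g (h x) = f x.

(* [f], as an epimorphism onto its image, is essential (superfluous kernel). *)
Definition essential_onto_image M N (f : {linear M -> N}) : Prop :=
  forall (X : lmodType R) (h : {linear X -> M}),
    (forall y, exists x, f (h x) = f y) -> surjective h.

(* P0 --f--> P1 --g--> M --> 0 is exact, and P1 -> M, P0 -> ker g are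
   projective covers. *)
Definition min_proj_presentation P0 P1 M
    (f : {linear P0 -> P1}) (g : {linear P1 -> M}) : Prop :=
  [/\ projective P0 /\ fin_gen P0, projective P1 /\ fin_gen P1,
      surjective g /\ essential_onto_image g,
      (forall y, g y = 0 <-> exists x, f x = y) &
      essential_onto_image f].

Definition in_left_ideal (e : R) : {pred R^o} := fun a => `[< exists b : R, a = b * e >].

Fact in_left_ideal_submod e : submod_closed (in_left_ideal e).
Proof.
split=> [|c a b /asboolP[a' ->] /asboolP[b' ->]]; apply/asboolP.
  by exists 0; rewrite mul0r.
by exists (c * a' + b'); rewrite mulrDl -mulrA.
Qed.
HB.instance Definition _ e := GRing.isSubmodClosed.Build R R^o (in_left_ideal e)
  (in_left_ideal_submod e).

Definition left_ideal (e : R) := {a : R^o | a \in in_left_ideal e}.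
HB.instance Definition _ e := [isSub of left_ideal e for @sval _ _].
HB.instance Definition _ e := [Choice of left_ideal e by <:].
HB.instance Definition _ e := [SubChoice_isSubLmodule of left_ideal e by <:].

(* P is the direct sum of the U i for i in I; the components of [dinj] and
   [dprj] at indices outside I are irrelevant. *)
Record dsum_decomp (T : finType) (U : T -> lmodType R) (P : lmodType R)
    (I : {set T}) := DsumDecomp {
  dinj : forall i, {linear U i -> P};
  dprj : forall i, {linear P -> U i};
  dprj_inj : forall i x, i \in I -> dprj i (dinj i x) = x;
  dprj_inj0 : forall i j x, i \in I -> j \in I -> i != j -> dprj j (dinj i x) = 0;
  dinj_prj : forall x, \sum_(i in I) dinj i (dprj i x) = x }.

(* Cohomological cochain complexes; [cdiff n m] is only relevant for m = n + 1. *)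
Record complex := Complex {
  cterm :> int -> lmodType R;
  cdiff : forall n m, {linear cterm n -> cterm m};
  cdiff_shape : forall n m x, m != n + 1 -> cdiff n m x = 0;
  cdiff_comp : forall n m k x, cdiff m k (cdiff n m x) = 0 }.

Implicit Types X Y Z W : complex.

Definition bounded X : Prop :=
  exists b : nat, forall n : int, (b < `|n|)%N -> zero_module (X n).

Definition perfect X : Prop :=
  bounded X /\ forall n, projective (X n) /\ fin_gen (X n).

Record cmap X Y := Cmap {
  cmapf :> forall n, {linear X n -> Y n};
  cmapC : forall n m x, cdiff Y n m (cmapf n x) = cmapf m (cdiff X n m x) }.

Definition null_homotopic X Y (f : forall n, X n -> Y n) : Prop :=
  exists h : forall n m, {linear X n -> Y m}, forall n x,
    f n x = cdiff Y (n - 1) n (h n (n - 1) x) + h (n + 1) n (cdiff X n (n + 1) x).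

Definition hom_Kb_nonzero X Y : Prop := exists f : cmap X Y, ~ null_homotopic (fun n => f n).

(* f induces an injection (first clause) and a surjection (second clause)
   on cohomology. *)
Definition quasi_iso X Y (f : cmap X Y) : Prop :=
  (forall n (x : X n), cdiff X n (n + 1) x = 0 ->
     (exists y, f n x = cdiff Y (n - 1) n y) -> exists x', x = cdiff X (n - 1) n x') /\
  (forall n (y : Y n), cdiff Y n (n + 1) y = 0 ->
     exists x y', cdiff X n (n + 1) x = 0 /\ y = f n x + cdiff Y (n - 1) n y').

Definition in_Db X : Prop := bounded X /\ forall n, fin_gen (X n).

(* Hom_{D^b(R)}(X, Y) = 0: a morphism of D^b is a fraction X <-s- Z -f-> Y with
   s a quasi-isomorphism, and it vanishes iff f becomes null-homotopic after
   composition with a quasi-isomorphism W -> Z. *)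
Definition hom_Db_zero X Y : Prop :=
  forall (Z : complex) (s : cmap Z X) (f : cmap Z Y), in_Db Z -> quasi_iso s ->
  exists (W : complex) (t : cmap W Z),
    [/\ in_Db W, quasi_iso t & @null_homotopic W Y (fun n x => f n (t n x))].

Section Shift.
Variables (X : complex) (i : int).
Definition shift_diff n m : {linear X (n + i) -> X (m + i)} :=
  if odd `|i|%N as _ return {linear X (n + i) -> X (m + i)}
  then \- cdiff X (n + i) (m + i) else cdiff X (n + i) (m + i).
Fact shift_shape n m x : m != n + 1 -> shift_diff n m x = 0.
Proof.
move=> ne; have ne' : m + i != (n + i) + 1 by rewrite addrAC (inj_eq (addIr i)).
by rewrite /shift_diff; case: odd; rewrite /= cdiff_shape ?oppr0.
Qed.
Fact shift_comp n m k x : shift_diff m k (shift_diff n m x) = 0.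
Proof.
rewrite /shift_diff; case: odd => /=; last by rewrite cdiff_comp.
by rewrite (linearN (cdiff X (m + i) (k + i))) cdiff_comp !oppr0.
Qed.
(* X[i]^n = X^(n+i), with differential (-1)^i d. *)
Definition shift : complex :=
  @Complex (fun n => X (n + i)) shift_diff shift_shape shift_comp.
End Shift.

Definition partial_tilting X : Prop :=
  perfect X /\ forall i : int, i != 0 -> hom_Db_zero X (shift X i).

Definition pair_map (U1 U2 V1 V2 : lmodType R) (f : {linear U1 -> V1})
  (g : {linear U2 -> V2}) (p : U1 * U2) : V1 * V2 := (f p.1, g p.2).

Fact pair_map_linear (U1 U2 V1 V2 : lmodType R) (f : {linear U1 -> V1}) (g : {linear U2 -> V2}) :
  linear (pair_map f g).
Proof. by move=> a [x y] [x' y']; rewrite /pair_map /= !linearP. Qed.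
HB.instance Definition _ (U1 U2 V1 V2 : lmodType R) (f : {linear U1 -> V1})
    (g : {linear U2 -> V2}) :=
  GRing.isLinear.Build R (U1 * U2)%type (V1 * V2)%type *:%R (pair_map f g)
    (pair_map_linear f g).

Section DirectSum.
Variables X Y : complex.
Definition dsum_diff n m : {linear (X n * Y n)%type -> (X m * Y m)%type} :=
  pair_map (cdiff X n m) (cdiff Y n m).
Fact dsum_shape n m x : m != n + 1 -> dsum_diff n m x = 0.
Proof. by move=> ne; rewrite /dsum_diff /= /pair_map !cdiff_shape. Qed.
Fact dsum_comp n m k x : dsum_diff m k (dsum_diff n m x) = 0.
Proof. by rewrite /dsum_diff /= /pair_map /= !cdiff_comp. Qed.
Definition dsum : complex :=
  @Complex (fun n => (X n * Y n)%type) dsum_diff dsum_shape dsum_comp.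
End DirectSum.

Definition zero_mod : lmodType R := 'rV[R]_0.

Section TwoTerm.
Variables (P0 P1 : lmodType R) (f : {linear P0 -> P1}).
Definition two_term_obj (n : int) : lmodType R :=
  match n with Posz 0 => P0 | Posz 1 => P1 | _ => zero_mod end.
Definition two_term_diff n m : {linear two_term_obj n -> two_term_obj m} :=
  match n, m return {linear two_term_obj n -> two_term_obj m} with
  | Posz 0, Posz 1 => f
  | _, _ => \0
  end.
Fact two_term_shape n m x : m != n + 1 -> two_term_diff n m x = 0.
Proof. by case: n x => [[|[|n]]|n] x; case: m => [[|[|m]]|m]. Qed.
Fact two_term_comp n m k x : two_term_diff m k (two_term_diff n m x) = 0.
Proof.
by case: n x => [[|[|n]]|n] x; case: m => [[|[|m]]|m]; case: k => [[|[|k]]|k] //=;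
   rewrite linear0.
Qed.
(* P0 in degree 0 and P1 in degree 1. *)
Definition two_term : complex :=
  @Complex two_term_obj two_term_diff two_term_shape two_term_comp.
End TwoTerm.

Section Stalk.
Variable P : lmodType R.
Definition stalk_obj (n : int) : lmodType R :=
  if n is Posz 0 then P else zero_mod.
Definition stalk_diff n m : {linear stalk_obj n -> stalk_obj m} := \0.
Fact stalk_shape n m x : m != n + 1 -> stalk_diff n m x = 0.
Proof. by []. Qed.
Fact stalk_comp n m k x : stalk_diff m k (stalk_diff n m x) = 0.
Proof. by []. Qed.
Definition stalk : complex := @Complex stalk_obj stalk_diff stalk_shape stalk_comp.
End Stalk.

End Modules.

Definition edge_adj (V E : finType) (ends : E -> {set V}) : rel V :=
  fun u v => (u != v) && [exists i, ends i == [set u; v]].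

(* A finite tree with a cyclic ordering of the edges around each vertex:
   [cyc v] lists the edges at v, read cyclically.  [fam v] is the family
   (alpha or beta) of the arrows of the oriented cycle at v. *)
Record brauer_tree := BrauerTree {
  bvert : finType;
  bedge : finType;
  ends : bedge -> {set bvert};
  cyc : bvert -> seq bedge;
  fam : bvert -> bool;
  ends_card : forall i, #|ends i| = 2;
  ends_inj : injective ends;
  tree_connected : forall u v, connect (edge_adj ends) u v;
  tree_acyclic : forall c, ucycle (edge_adj ends) c -> (size c <= 2)%N;
  cyc_uniq : forall v, uniq (cyc v);
  mem_cyc : forall v i, (i \in cyc v) = (v \in ends i);
  fam_neq : forall i u v, u \in ends i -> v \in ends i -> u != v -> fam u != fam v }.

Section BrauerTree.
Variable G : brauer_tree.

(* The arrow (v, i) starts at i and belongs to the cycle at v. *)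
Definition barrow := {a : bvert G * bedge G | a.1 \in ends a.2}.
HB.instance Definition _ := SubFinite.on barrow.

Definition arr_vert (a : barrow) : bvert G := (val a).1.
Definition arr_src (a : barrow) : bedge G := (val a).2.
Definition arr_tgt (a : barrow) : bedge G := next (cyc (arr_vert a)) (arr_src a).

Definition brauer_quiver : quiver := Quiver arr_src arr_tgt.

(* The vertices of the quiver lying on the A-cycle attached to v. *)
Definition Acycle (v : bvert G) : {set bedge G} := [set i | v \in ends i].

Section Algebra.
Variable K : fieldType.
Local Notation KQ := (path_alg K brauer_quiver).

Definition arrowU (a : barrow) : KQ := pathU K (@arrow_path brauer_quiver a).

(* The arrow of the cycle at v starting at i (0 if v is not an end of i). *)
Definition arrow_at (v : bvert G) (i : bedge G) : KQ :=
  if insub (v, i) is Some a then arrowU a else 0.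

(* Once around the cycle at v, from i to i. *)
Definition full_turn (v : bvert G) (i : bedge G) : KQ :=
  \prod_(k <- traject (next (cyc v)) i (size (cyc v))) arrow_at v k.

Inductive brauer_rel : KQ -> Prop :=
| rel_alpha_beta (a b : barrow) :
    fam (arr_vert a) != fam (arr_vert b) -> brauer_rel (arrowU a * arrowU b)
| rel_full_turns (i : bedge G) (u v : bvert G) :
    u \in ends i -> v \in ends i -> brauer_rel (full_turn u i - full_turn v i).

(* Elements of the algebra are products of paths read from left to right, so
   A e_i is spanned by the paths ending at i, and the morphisms A e_i -> A e_j
   are the right multiplications by combinations of paths from i to j. *)
Definition brauer_alg : pzRingType := ring_quot brauer_rel.

Definition idem (i : bedge G) : brauer_alg :=
  quot_pi brauer_rel (pathU K (@trivial_path brauer_quiver i)).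

Definition proj_at (i : bedge G) : lmodType brauer_alg := left_ideal (idem i).

(* The summands A e_i of the terms of a minimal presentation P0 -> P1 have
   pairwise distinct indices, so these form sets I and J of quiver vertices. *)
Section Diagram.
Variables (P0 P1 : lmodType brauer_alg) (f : {linear P0 -> P1}).
Variables (I J : {set bedge G}).
Variables (D0 : dsum_decomp proj_at P0 I) (D1 : dsum_decomp proj_at P1 J).

Definition component (i j : bedge G) (a : proj_at i) : proj_at j :=
  dprj D1 j (f (dinj D0 i a)).

Definition linked (i j : bedge G) : bool :=
  [&& i \in I, j \in J & `[< exists a : proj_at i, component j a <> 0 >]].

(* [arc c i j] lists the items of the cyclic sequence c from i (included)
   to j (excluded), hence the sources of the arrows of the path from i to j. *)
Definition diag_arrows : {set barrow} :=
  [set a | [exists i, exists j,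
     [&& linked i j, i \in Acycle (arr_vert a), j \in Acycle (arr_vert a)
       & arr_src a \in arc (cyc (arr_vert a)) i j]]].

Definition diag_verts : {set bedge G} :=
  I :|: J :|: [set arr_src a | a in diag_arrows] :|: [set arr_tgt a | a in diag_arrows].

(* Degree in the marked subquiver: the number of incident marked arrows. *)
Definition diag_degree (k : bedge G) : nat :=
  #|[set a in diag_arrows | arr_src a == k]| +
  #|[set a in diag_arrows | arr_tgt a == k]|.

End Diagram.
End Algebra.
End BrauerTree.

(* Main.v *)
Require Import Defs.
From HB Require Import structures.
From mathcomp Require Import all_boot all_order all_algebra finmap zify.
From mathcomp.classical Require Import boolp.
From mathcomp.multinomials Require Import monalg.

Set Implicit Arguments.
Unset Strict Implicit.
Unset Printing Implicit Defensive.

(* Write I_w, J_w for the sets of sources and sinks lying on the cycle at w.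

   Hom(T, P) is the space of maps P0 -> P modulo those factoring through f, and
   the two consequences of tilting that matter are elementary: Hom(T, T[-1]) = 0
   forces I and J to be disjoint (otherwise multiplication by a socle element is
   a nonzero map P1 -> P0 composing to 0 with f on both sides), and
   Hom(P, T[1]) = 0 says that every map Ae_x -> P1 lands in the image of f.

   The shape of T: |I_w| and |J_w| are at most 1 for every w. Choose the shortest
   link i -> j on the cycle at w; all other entries of f in row i and column j
   along this cycle factor through it, so a change of decompositions clears them.
   Since the two far ends of i and j are separated from everything else in the
   tree once i and j are cut off at w, f then splits as a direct sum, and the
   indecomposability of M leaves nothing outside. The same splitting argument
   shows that the diagram is connected.

   If i is a source with J_u empty for one end u of i, then any nonzero map
   Ae_i -> Ae_x along the cycle at u cannot factor through f, as the entries of f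
   out of i belong to the other family. If there is no such i and u with u in x,
   every component Ae_i -> Ae_x of a map P0 -> P runs along a cycle that has a sink
   j: either j comes before x and the component factors through i -> j, or x lies
   strictly between i and j and the path x -> j is not in the image of f,
   contradicting tilting. *)

(** * Cutting the tree at an edge *)

Section Tree.
Variable G : brauer_tree.
Implicit Types (u v w : bvert G) (i j k : bedge G).

Lemma ends_eq i u v : u \in ends i -> v \in ends i -> u != v -> ends i = [set u; v].
Proof.
move=> ui vi uv; apply/esym/eqP.
by rewrite eqEcard cards2 uv ends_card subUset !sub1set ui vi.
Qed.

Lemma common_end i j u v : i != j -> u \in ends i -> v \in ends i ->
  u \in ends j -> v \in ends j -> u = v.
Proof.
move=> ij ui vi uj vj; apply/eqP; apply: contraNT ij => uv.
by apply/eqP/ends_inj; rewrite (ends_eq ui vi uv) (ends_eq uj vj uv).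
Qed.

Lemma other_end i u : u \in ends i -> exists2 v, v \in ends i & v != u.
Proof.
move=> ui; have: (0 < #|ends i :\ u|)%N.
  by have := cardsD1 u (ends i); rewrite ui ends_card add1n => -[<-].
by case/card_gt0P=> v /setD1P[vu vi]; exists v.
Qed.

Lemma ends_case i u v w : u \in ends i -> v \in ends i -> u != v -> w \in ends i -> w = u \/ w = v.
Proof. by move=> ui vi uv; rewrite (ends_eq ui vi uv) => /set2P. Qed.

Definition adj_without k : rel (bvert G) :=
  fun u v => (u != v) && [exists i, (i != k) && (ends i == [set u; v])].

Lemma adj_withoutP k i u v : i != k -> u \in ends i -> v \in ends i -> connect (adj_without k) u v.
Proof.
move=> ik ui vi; have [->//|uv] := eqVneq u v; apply: connect1.
by rewrite /adj_without uv; apply/existsP; exists i; rewrite ik (ends_eq ui vi uv) /=.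
Qed.

Lemma adj_without_sym k : connect_sym (adj_without k).
Proof.
apply: sym_connect_sym => u v; rewrite /adj_without eq_sym; congr (_ && _).
by apply: eq_existsb => i; rewrite setUC.
Qed.

(** A path from [u] to [v] avoiding [k], once shortened and closed up by [k], is a cycle. If it has
    a single step, the edge used has the ends of [k], against [ends_inj]; otherwise [tree_acyclic]
    is violated. *)
Lemma bridge k u v : u \in ends k -> v \in ends k -> u != v -> ~~ connect (adj_without k) u v.
Proof.
move=> uk vk uv; apply/negP=> /connectP[p0 pth0 lst0].
case/shortenP: pth0 lst0 => p pth unq _ lst {p0}.
have [|lt2] := leqP (size p).+1 2.
  case: p pth unq lst => [|y [|//]] /=; first by move=> _ _ vu; rewrite vu eqxx in uv.
  rewrite andbT => adj _ vy _; subst y; case/andP: adj => _ /existsP[i /andP[ik /eqP ei]].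
  by move/negP: ik; apply; apply/eqP/ends_inj; rewrite ei (ends_eq uk vk uv).
have: ucycle (edge_adj (@ends G)) (u :: p).
  rewrite /ucycle unq andbT /= rcons_path; apply/andP; split.
    apply: sub_path pth => y z /andP[yz /existsP[i /andP[_ ei]]].
    by rewrite /edge_adj yz; apply/existsP; exists i.
  rewrite -lst /edge_adj eq_sym uv; apply/existsP; exists k.
  by rewrite (ends_eq uk vk uv) setUC.
by move/tree_acyclic; rewrite /= leqNgt lt2.
Qed.

(** For an end [v] of [k]: [k] itself together with the edges on the side of [v] once [k] is
    removed. *)
Definition branch k v : {set bedge G} :=
  [set i | [exists u, (u \in ends i) && connect (adj_without k) v u]].

Lemma branchP k v i :
  reflect (exists2 u, u \in ends i & connect (adj_without k) v u) (i \in branch k v).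
Proof.
rewrite inE; apply: (iffP existsP) => [[u /andP[]]|[u ui vu]]; exists u => //.
by rewrite ui.
Qed.

Lemma branch_self k v : v \in ends k -> k \in branch k v.
Proof. by move=> vk; apply/branchP; exists v. Qed.

Lemma notin_branch k u v i : u \in ends k -> v \in ends k -> u != v ->
  u \in ends i -> i != k -> i \notin branch k v.
Proof.
move=> uk vk uv ui ik; apply/branchP=> -[y yi vy].
move/negP: (bridge uk vk uv); apply; rewrite adj_without_sym.
by apply: connect_trans vy _; apply: adj_withoutP yi ui.
Qed.

(** A common end [w] of [i] and [j] cannot be joined to [v] without [k], since [j] would then belong
    to the branch. As every edge of the branch other than [k] has both ends joined to [v], only [k]
    and its far end [u] remain. *)
Lemma branch_exit k u v i j w : u \in ends k -> v \in ends k -> u != v ->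
  i \in branch k v -> j \notin branch k v -> w \in ends i -> w \in ends j ->
  i = k /\ w = u.
Proof.
move=> uk vk uv /branchP[y yi vy] jb wi wj.
have nvw : ~~ connect (adj_without k) v w.
  by apply: contra jb => vw; apply/branchP; exists w.
have ik : i = k.
  apply/eqP; apply: contraNT nvw => ik.
  by apply: connect_trans vy _; apply: adj_withoutP wi.
split=> //; subst i; have [//|wv] := ends_case uk vk uv wi.
by rewrite wv connect0 in nvw.
Qed.

End Tree.

Import GRing.Theory.
Local Open Scope ring_scope.

(** * The Brauer tree algebra *)

Section RingQuotientFacts.
Variables (R : pzRingType) (rel : R -> Prop).
Local Notation pi := (quot_pi rel).

Lemma quot_pi0 : pi 0 = 0.
Proof. by apply: (addrI (pi 0)); rewrite -quot_piD !addr0. Qed.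

Lemma quot_pi1 : pi 1 = 1.
Proof. by []. Qed.

Lemma quot_piN x : pi (- x) = - pi x.
Proof. by apply: (addrI (pi x)); rewrite -quot_piD !subrr quot_pi0. Qed.

Lemma quot_piB x y : pi (x - y) = pi x - pi y.
Proof. by rewrite quot_piD quot_piN. Qed.

Lemma quot_pi_rel x : rel x -> pi x = 0.
Proof.
move=> rx; rewrite -quot_pi0; apply/quot_piP; rewrite subr0.
exists 1%N, (fun=> 1), (fun=> x), (fun=> 1); split=> //.
by rewrite big_ord1 mul1r mulr1.
Qed.

End RingQuotientFacts.

Section PathAlgebraFacts.
Variables (K : fieldType) (Q : quiver).
Implicit Types (x y : path_alg K Q) (p q r : qpath Q).

Lemma path_scaleAl c x y : c *: x * y = c *: (x * y) :> path_alg K Q.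
Proof. exact: path_mulZl. Qed.

Lemma path_scaleAr c x y : x * (c *: y) = c *: (x * y) :> path_alg K Q.
Proof. exact: path_mulZr. Qed.

Lemma pathU_cat p q : pend p = psrc q ->
  exists2 r, (pathU K p : path_alg K Q) * pathU K q = pathU K r &
             val r = (psrc p, (val p).2 ++ (val q).2).
Proof. by move=> /pcatE[r pr vr]; exists r => //; rewrite pathUM pr. Qed.

Lemma pathU_cat0 p q : pend p <> psrc q ->
  (pathU K p : path_alg K Q) * pathU K q = 0.
Proof. by move=> pq; rewrite pathUM pcat_none. Qed.

Lemma pathU_src p (x : qvert Q) : x = psrc p ->
  (pathU K (trivial_path x) : path_alg K Q) * pathU K p = pathU K p.
Proof. by move=> ->; rewrite pathUM pcat1p eqxx. Qed.

Lemma pathU_end p (x : qvert Q) : x = pend p ->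
  (pathU K p : path_alg K Q) * pathU K (trivial_path x) = pathU K p.
Proof. by move=> ->; rewrite pathUM pcatp1 eqxx. Qed.

Section LinearExtension.
Variable h : qpath Q -> K.

Definition path_ext x : K := mmap idfun h x.

Lemma path_ext0 : path_ext 0 = 0.
Proof. exact: mmap0. Qed.

Lemma path_extD x y : path_ext (x + y) = path_ext x + path_ext y.
Proof. exact: mmapD. Qed.

Lemma path_extB x y : path_ext (x - y) = path_ext x - path_ext y.
Proof. exact: mmapB. Qed.

Lemma path_extU p : path_ext (pathU K p) = h p.
Proof. by rewrite /path_ext pathUE mmapU mul1r. Qed.

Lemma path_extZ c x : path_ext (c *: x) = c * path_ext x.
Proof.
rewrite /path_ext (mmapEw (msuppZ_le _ _)) mmapE mulr_sumr.
by apply: eq_bigr => p _; rewrite mcoeffZ mulrA.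
Qed.

Lemma path_ext_ideal (rel : path_alg K Q -> Prop) :
    (forall p q (r : path_alg K Q), rel r -> path_ext ((pathU K p : path_alg K Q) * r * pathU K q) = 0) ->
  forall x, in_ideal rel x -> path_ext x = 0.
Proof.
move=> h0 _ [n [a [r [b [hr ->]]]]].
elim/big_ind: _ => [|x y ex ey|k _]; first exact: path_ext0.
  by rewrite path_extD ex ey addr0.
move: (r k) (hr k) (a k) (b k) => {hr}r hr.
elim/path_alg_ind => [|x y IHx IHy|c p] z.
- by rewrite !mul0r path_ext0.
- by rewrite !mulrDl path_extD IHx IHy addr0.
rewrite !path_scaleAl path_extZ.
elim/path_alg_ind: z => [|x y IHx IHy|c' q].
- by rewrite !mulr0 path_ext0 mulr0.
- by rewrite mulrDr path_extD mulrDr IHx IHy addr0.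
by rewrite path_scaleAr path_extZ h0 // !mulr0.
Qed.

End LinearExtension.

End PathAlgebraFacts.

(** * Distances in the cyclic orders *)

Section CyclicOrder.
Variable G : brauer_tree.
Implicit Types (u v w : bvert G) (i j k : bedge G).

Definition turnv w n i := iter n (next (cyc w)) i.
(** Number of steps from [i] forward to [j] around [w]; it is 0, not a full turn, when [i = j]. *)
Definition cdist w i j := findex (next (cyc w)) i j.

Lemma turnv_end w n i : (w \in ends (turnv w n i)) = (w \in ends i).
Proof. by elim: n => //= n; rewrite -!mem_cyc mem_next. Qed.

Lemma turnvD w m n i : turnv w (m + n) i = turnv w m (turnv w n i).
Proof. exact: iterD. Qed.

Section Dist.
Variables (w : bvert G) (i : bedge G).
Hypothesis wi : w \in ends i.

Let wic : i \in cyc w. Proof. by rewrite mem_cyc. Qed.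
Let ord : order (next (cyc w)) i = size (cyc w).
Proof. exact (order_cycle (cycle_next (cyc_uniq w)) (cyc_uniq w) wic). Qed.
Let conn j : w \in ends j -> fconnect (next (cyc w)) i j.
Proof.
by move=> wj; rewrite (fconnect_cycle (cycle_next (cyc_uniq w)) wic) mem_cyc.
Qed.

Lemma size_cyc_gt0 : (0 < size (cyc w))%N.
Proof. by case: (cyc w) wic. Qed.

Lemma turnv_cdist j : w \in ends j -> turnv w (cdist w i j) i = j.
Proof. by move=> wj; apply: iter_findex (conn wj). Qed.

Lemma cdist_lt j : w \in ends j -> (cdist w i j < size (cyc w))%N.
Proof. by move=> wj; rewrite -ord; apply: findex_max (conn wj). Qed.

Lemma cdist_turnv n : (n < size (cyc w))%N -> cdist w i (turnv w n i) = n.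
Proof. by rewrite -ord; apply: findex_iter. Qed.

Lemma cdist_gt0 j : (0 < cdist w i j)%N = (i != j).
Proof. by rewrite lt0n /cdist findex_eq0. Qed.

Lemma turnv_size : turnv w (size (cyc w)) i = i.
Proof. by rewrite -ord; exact (iter_order_cycle (cycle_next (cyc_uniq w)) wic wic). Qed.

End Dist.

Lemma cdistD w i j k : w \in ends i -> w \in ends j -> w \in ends k ->
  (cdist w i j + cdist w j k = cdist w i k \/
   cdist w i j + cdist w j k = cdist w i k + size (cyc w))%N.
Proof.
move=> wi wj wk; set m := cdist w i j; set n := cdist w j k.
have lm : (m < size (cyc w))%N by apply: cdist_lt.
have ln : (n < size (cyc w))%N by apply: cdist_lt.
have tk : turnv w (m + n) i = k by rewrite addnC turnvD !turnv_cdist.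
have [lt|ge] := ltnP (m + n) (size (cyc w)).
  by left; rewrite -(cdist_turnv wi lt) tk.
right; rewrite -(subnK ge) turnvD turnv_size // in tk.
by rewrite -tk cdist_turnv ?subnK //; lia.
Qed.

(** Otherwise walking from [k] to [i] and on to [j] would complete a turn, which makes [cdist w k i]
    at least the length of the cycle. So the path from [i] is a tail of the path from [k]. *)
Lemma cdist_closer_source w i j k : w \in ends i -> w \in ends j -> w \in ends k ->
  (cdist w i j <= cdist w k j)%N -> (cdist w k i + cdist w i j = cdist w k j)%N.
Proof.
move=> wi wj wk le; have [//|] := cdistD wk wi wj.
by have := cdist_lt wk wi; lia.
Qed.

Lemma cdist_closer_target w i j l : w \in ends i -> w \in ends j -> w \in ends l ->
  (cdist w i j <= cdist w i l)%N -> (cdist w i j + cdist w j l = cdist w i l)%N.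
Proof.
move=> wi wj wl le; have [//|] := cdistD wi wj wl.
by have := cdist_lt wj wl; lia.
Qed.

Lemma cdist_return w i j : w \in ends i -> w \in ends j -> i != j ->
  (cdist w i j + cdist w j i = size (cyc w))%N.
Proof.
move=> wi wj ij; have := cdistD wi wj wi.
have -> : cdist w i i = 0%N by apply/eqP; rewrite -leqn0 leqNgt cdist_gt0 eqxx.
by have := cdist_gt0 w i j; rewrite ij; lia.
Qed.

(** The equation says that [x] lies strictly between [i] and [j]; the conclusion makes the path from
    [x] through [i] to [j] longer than a full turn, hence zero in the algebra. *)
Lemma cdist_wrap w i j x : w \in ends i -> w \in ends j -> w \in ends x -> i != x ->
  (cdist w i j + cdist w j x = cdist w i x + size (cyc w))%N ->
  (size (cyc w) < cdist w x i + cdist w i j)%N.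
Proof.
move=> wi wj wx ix E; have := cdist_return wi wx ix.
by have := cdist_lt wj wx; lia.
Qed.

End CyclicOrder.

(** * Multiplication of paths in the Brauer tree algebra *)

Section BrauerAlgebra.
Variables (G : brauer_tree) (K : fieldType).
Implicit Types (u v w : bvert G) (i j k : bedge G) (a b : barrow G).

Local Notation Q := (brauer_quiver G).
Local Notation KQ := (path_alg K Q).
Local Notation A := (brauer_alg G K).
Local Notation pi := (quot_pi (@brauer_rel G K)).
Local Notation e := (@idem G K).

(** The quotient is formed as a ring only; these central elements carry its structure over [K]. *)
Definition brauer_scal (c : K) : A := pi (c *: (1 : KQ) : KQ).

Lemma scalE c (x : KQ) : pi (c *: x) = brauer_scal c * pi x.
Proof. by rewrite -quot_piM path_scaleAl mul1r. Qed.

Lemma brauer_scalC c (x : A) : x * brauer_scal c = brauer_scal c * x.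
Proof.
by rewrite -[x]quot_pi_repr -!quot_piM path_scaleAl path_scaleAr mul1r mulr1.
Qed.

Lemma brauer_scalM c d : brauer_scal (c * d) = brauer_scal c * brauer_scal d.
Proof. by rewrite /brauer_scal -scalE scalerA. Qed.

Lemma brauer_scalD c d : brauer_scal (c + d) = brauer_scal c + brauer_scal d.
Proof. by rewrite /brauer_scal scalerDl quot_piD. Qed.

Lemma brauer_scal0 : brauer_scal 0 = 0.
Proof. by rewrite /brauer_scal scale0r quot_pi0. Qed.

Lemma brauer_scal1 : brauer_scal 1 = 1.
Proof. by rewrite /brauer_scal scale1r quot_pi1. Qed.

Definition brauer_turn w n i : A :=
  pi (\prod_(k <- traject (next (cyc w)) i n) arrow_at K w k).

Lemma brauer_idemM i j : e i * e j = if i == j then e i else 0.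
Proof.
rewrite /idem -quot_piM pathUM pcat1p /psrc /=.
case: eqP => [->|_] //=; exact: quot_pi0.
Qed.

Lemma idem_idem i : e i * e i = e i.
Proof. by rewrite brauer_idemM eqxx. Qed.

Lemma arrow_srcE a : pi (arrowU K a) = e (arr_src a) * pi (arrowU K a).
Proof. by rewrite -quot_piM; congr (pi _); apply/esym; exact: pathU_src. Qed.

Lemma arrow_tgtE a : pi (arrowU K a) = pi (arrowU K a) * e (arr_tgt a).
Proof. by rewrite -quot_piM; congr (pi _); apply/esym; exact: pathU_end. Qed.

Lemma arr_srcP a : arr_vert a \in ends (arr_src a).
Proof. exact: (valP a). Qed.

Lemma arr_tgtP a : arr_vert a \in ends (arr_tgt a).
Proof. by rewrite /arr_tgt -mem_cyc mem_next mem_cyc arr_srcP. Qed.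

(** If the arrows can be composed, both their cycles pass through the vertex where they meet, so
    [fam_neq] puts them in different families and their product is a relation. Otherwise the
    idempotents between them kill the product. *)
Lemma arrow_mul0 a b : arr_vert a != arr_vert b ->
  pi (arrowU K a) * pi (arrowU K b) = 0.
Proof.
move=> ab; have [st|st] := eqVneq (arr_tgt a) (arr_src b); last first.
  by rewrite (arrow_tgtE a) (arrow_srcE b) mulrA -(mulrA _ (e _) (e _)) brauer_idemM (negbTE st) mulr0 mul0r.
rewrite -quot_piM; apply/quot_pi_rel/rel_alpha_beta.
apply: fam_neq ab; last exact: arr_srcP.
by rewrite -st arr_tgtP.
Qed.

Lemma arrow_atP w i : w \in ends i ->
  exists2 a, arr_vert a = w /\ arr_src a = i & arrow_at K w i = arrowU K a.
Proof.
move=> wi; rewrite /arrow_at.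
case: insubP => [a _ va|]; last by rewrite /= wi.
by exists a => //; rewrite /arr_vert /arr_src va.
Qed.

Lemma turn1P w i : w \in ends i ->
  exists2 a, arr_vert a = w /\ arr_src a = i & brauer_turn w 1 i = pi (arrowU K a).
Proof.
move=> /arrow_atP[a va ea]; exists a => //.
by rewrite /brauer_turn /= big_seq1 ea.
Qed.

Lemma brauer_turnD w m n i : brauer_turn w (m + n) i = brauer_turn w m i * brauer_turn w n (turnv w m i).
Proof. by rewrite /brauer_turn trajectD big_cat /= quot_piM. Qed.

Lemma brauer_turn_src w n i : w \in ends i -> (0 < n)%N -> e i * brauer_turn w n i = brauer_turn w n i.
Proof.
case: n => // n wi _; rewrite -add1n brauer_turnD.
by have [a [_ sa] ->] := turn1P wi; rewrite (arrow_srcE a) !mulrA sa idem_idem.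
Qed.

Lemma brauer_turn_tgt w n i : w \in ends i -> (0 < n)%N ->
  brauer_turn w n i * e (turnv w n i) = brauer_turn w n i.
Proof.
case: n => // n wi _; rewrite -addn1 brauer_turnD -mulrA addn1; congr (_ * _).
have [|a [va sa] ->] := @turn1P w (turnv w n i); first by rewrite turnv_end.
rewrite [RHS]arrow_tgtE; congr (_ * e _).
by rewrite /arr_tgt va sa.
Qed.

Lemma brauer_turn_mul0 u w m n i j : u != w -> u \in ends i -> w \in ends j ->
  (0 < m)%N -> (0 < n)%N -> brauer_turn u m i * brauer_turn w n j = 0.
Proof.
case: m n => // m [] // n uw ui wj _ _; rewrite -(addn1 m) -(add1n n) !brauer_turnD.
have [|a [va _] ->] := @turn1P u (turnv u m i); first by rewrite turnv_end.
have [b [vb _] ->] := turn1P wj.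
by rewrite mulrA -(mulrA _ _ (pi (arrowU K b))) arrow_mul0 ?mulr0 ?mul0r // va vb.
Qed.

Lemma brauer_turn_full u w i : u \in ends i -> w \in ends i ->
  brauer_turn u (size (cyc u)) i = brauer_turn w (size (cyc w)) i.
Proof.
move=> ui wi; apply/eqP; rewrite -subr_eq0 -quot_piB; apply/eqP/quot_pi_rel.
exact: rel_full_turns.
Qed.

(** The first full turn may be replaced by the full turn around the other end of [i]; the next
    arrow, still on the cycle at [w], then changes cycle. *)
Lemma brauer_turn_gt w n i : w \in ends i -> (size (cyc w) < n)%N -> brauer_turn w n i = 0.
Proof.
move=> wi ltn; have [u ui uw] := other_end wi.
rewrite -(subnKC (ltnW ltn)) brauer_turnD (brauer_turn_full wi ui) brauer_turn_mul0 ?subn_gt0 //.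
  by rewrite turnv_end.
exact: (size_cyc_gt0 ui).
Qed.

(* The symmetrizing form of A: it reads off the coefficients of the full turns. *)
Definition full_path (p : qpath Q) : bool :=
  ((val p).2 != [::]) &&
  [exists w, all (fun a => arr_vert a == w) (val p).2 && (size (val p).2 == size (cyc w))].

Lemma prod_arrows w n i : w \in ends i ->
  exists2 r : qpath Q,
    \prod_(k <- traject (next (cyc w)) i n.+1) arrow_at K w k = (pathU K r : KQ) &
    [/\ psrc r = i, pend r = turnv w n.+1 i, size (val r).2 = n.+1
      & all (fun a => arr_vert a == w) (val r).2].
Proof.
elim: n i => [|n IH] i wi; have [a [va sa] ea] := arrow_atP wi.
  exists (@arrow_path Q a); first by rewrite /= big_seq1 ea.
  by split; rewrite /= ?va ?eqxx // /pend /walk_end /= /arr_tgt va sa.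
have [|r er [sr tr zr ar]] := IH (turnv w 1 i); first by rewrite turnv_end.
rewrite big_cons er ea; have pr : pend (@arrow_path Q a) = psrc r.
  by rewrite sr /pend /walk_end /= /arr_tgt va sa.
have [p -> vp] := pathU_cat K pr; exists p => //; split.
- by rewrite /psrc vp.
- rewrite /pend vp /walk_end map_cat last_cat; move: tr; rewrite /pend /walk_end.
  have -> : (val r).1 = last (arr_src a) [seq arr_tgt b | b <- [:: a]].
    by move: pr; rewrite /pend => /esym.
  by rewrite /= => ->; rewrite /turnv -iterSr.
- by rewrite vp /= zr.
- by rewrite vp /= va eqxx.
Qed.

Lemma full_turn_path w i : w \in ends i ->
  exists2 r : qpath Q, full_turn K w i = (pathU K r : KQ) &
    [/\ psrc r = i, pend r = i, size (val r).2 = size (cyc w)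
      & all (fun a => arr_vert a == w) (val r).2].
Proof.
move=> wi; have := prod_arrows (size (cyc w)).-1 wi.
by rewrite prednK ?(size_cyc_gt0 wi) // turnv_size.
Qed.

(** The two full turns at [i] both have value 1, and this value survives only multiplication by
    trivial paths, since lengthening a full turn spoils it. A path containing arrows of different
    families never lies on a single cycle. *)
Lemma full_path_rel (p q : qpath Q) (x : KQ) : brauer_rel x ->
  path_ext (fun p => (full_path p)%:R) ((pathU K p : KQ) * x * pathU K q) = 0.
Proof.
pose tau := path_ext (fun p => (full_path p)%:R : K).
have tau_cat (r : qpath Q) : psrc r = pend r -> (0 < size (val r).2)%N ->
    forall w, all (fun a => arr_vert a == w) (val r).2 ->
    size (val r).2 = size (cyc w) ->
    tau ((pathU K p : KQ) * pathU K r * pathU K q) =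
      [&& pend p == psrc r, psrc q == psrc r, nilp (val p).2 & nilp (val q).2]%:R.
  move=> sr r0 w ar zr; case: eqP => [pr|pr]; last first.
    by rewrite (pathU_cat0 K pr) mul0r; apply: path_ext0.
  have [s -> vs] := pathU_cat K pr.
  have es : pend s = pend r.
    rewrite /pend vs /walk_end map_cat last_cat.
    by move: pr; rewrite /pend /psrc /walk_end => ->.
  case: eqP => [qr|qr]; last first.
    by rewrite pathU_cat0; [apply: path_ext0|rewrite es -sr => /esym].
  have [|t -> vt] := @pathU_cat K Q s q; first by rewrite es -sr qr.
  rewrite /tau path_extU; congr (nat_of_bool _)%:R.
  rewrite /full_path vt vs /=; apply/andP/andP => [[_ /existsP[v]]|[]].
    rewrite !all_cat => /andP[/andP[/andP[_ av] _]] zv.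
    have vw : v = w.
      case: (val r).2 r0 ar av => //= a l _ /andP[/eqP <- _] /andP[/eqP <- _] //.
    move: zv; rewrite vw !size_cat zr /nilp.
    by case: (size (val p).2) => [|m]; case: (size (val q).2) => [|n] //;
      rewrite ?addn0 ?add0n ?addSn ?addnS => /eqP E; exfalso; move: E;
      elim: (size (cyc w)) => //; lia.
  move=> /nilP-> /nilP->; rewrite cats0 -size_eq0 -lt0n; split=> //.
  by apply/existsP; exists w; rewrite ar zr /=.
case=> [a b ab|i u v ui vi]; last first.
  have [r er [sr tr zr ar]] := full_turn_path ui.
  have [s es [ss ts zs as_]] := full_turn_path vi.
  rewrite er es mulrBr mulrBl path_extB.
  rewrite [X in X - _](tau_cat _ _ _ _ ar zr) ?sr ?tr ?zr ?(size_cyc_gt0 ui) //.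
  by rewrite [X in _ - X](tau_cat _ _ _ _ as_ zs) ?ss ?ts ?zs ?(size_cyc_gt0 vi) ?subrr.
rewrite /arrowU mulrA.
have [pa|pa] := pselect (pend p = psrc (@arrow_path Q a)); last first.
  by rewrite (pathU_cat0 K pa) !mul0r path_ext0.
have [r -> vr] := pathU_cat K pa.
have [rb|rb] := pselect (pend r = psrc (@arrow_path Q b)); last first.
  by rewrite (pathU_cat0 K rb) !mul0r path_ext0.
have [s -> vs] := pathU_cat K rb.
have [sq|sq] := pselect (pend s = psrc q); last by rewrite (pathU_cat0 K sq) path_ext0.
have [t -> vt] := pathU_cat K sq.
rewrite path_extU /full_path vt vs vr /=.
case: existsP => [[w]|]; last by rewrite andbF.
rewrite !all_cat /= !andbT => /andP[/andP[/andP[/andP[_ /eqP av] /eqP bv] _] _].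
by rewrite av bv eqxx in ab.
Qed.

(** The symmetrizing form takes the value 1 here. The nonvanishing of shorter paths and of
    idempotents is deduced from this. *)
Lemma brauer_full_turn_neq0 w i : w \in ends i -> brauer_turn w (size (cyc w)) i <> 0.
Proof.
move=> wi; have [r er [sr tr zr ar]] := full_turn_path wi.
rewrite /brauer_turn -/(full_turn K w i) -(quot_pi0 (@brauer_rel G K)) => /quot_piP.
rewrite subr0 er => /(path_ext_ideal full_path_rel) /eqP.
rewrite path_extU /full_path -size_eq0 zr -lt0n (size_cyc_gt0 wi) /=.
suff -> : [exists v, all (fun a => arr_vert a == v) (val r).2 && (size (cyc w) == size (cyc v))].
  by rewrite oner_eq0.
by apply/existsP; exists w; rewrite ar /=.
Qed.

Definition path_class (p : qpath Q) : A := pi (pathU K p).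

Lemma path_class_trivial i : path_class (@trivial_path Q i) = e i.
Proof. by []. Qed.

(** Induction on the number of arrows: putting an arrow in front of a turn either prolongs it on its
    cycle or changes cycle and gives zero. *)
Lemma path_turn (p : qpath Q) :
  [\/ p = @trivial_path Q (psrc p), path_class p = 0 |
   exists w n, [/\ w \in ends (psrc p), (0 < n)%N & path_class p = brauer_turn w n (psrc p)]].
Proof.
have [l lp] : exists l, (val p).2 = l by exists (val p).2.
rewrite /path_class; elim: l p lp => [|a l IH] p lp.
  apply: Or31; apply: val_inj; rewrite /psrc /= -lp; exact: surjective_pairing.
have := valP p; rewrite /= lp /= => /andP[/eqP sp wl].
pose q : qpath Q := exist (fun p => walk p.1 p.2) (qtgt a, l) wl.
have [|r er vr] := @pathU_cat K Q (@arrow_path Q a) q; first by [].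
have -> : p = r.
  by apply: val_inj; rewrite vr [val p]surjective_pairing lp -sp.
have -> : psrc r = arr_src a by rewrite /psrc vr.
have er' : pi (pathU K r) = pi (arrowU K a) * pi (pathU K q).
  by rewrite -quot_piM -er.
have a1 : brauer_turn (arr_vert a) 1 (arr_src a) = pi (arrowU K a).
  have [b [vb sb] ->] := turn1P (arr_srcP a).
  congr (pi (arrowU K _)); apply: val_inj; move: vb sb.
  by rewrite /arr_vert /arr_src; case: (val a) (val b) => ? ? [? ?] /= -> ->.
case: (IH q erefl) => [e0|e0|[w [n [wx n0 en]]]].
- apply: Or33; exists (arr_vert a), 1%N; split=> //; first exact: arr_srcP.
  by rewrite er' a1 e0 [RHS]arrow_tgtE.
- by apply: Or32; rewrite er' e0 mulr0.
rewrite er' en; have [wa|wa] := eqVneq (arr_vert a) w; last first.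
  by apply: Or32; rewrite -a1 brauer_turn_mul0 // arr_srcP.
apply: Or33; exists w, n.+1; split=> //; first by rewrite -wa; apply: arr_srcP.
by rewrite -add1n brauer_turnD -wa a1.
Qed.

Lemma brauer_span (P : A -> Prop) :
    P 0 -> (forall x y, P x -> P y -> P (x + y)) ->
    (forall c i, P (brauer_scal c * e i)) ->
    (forall c w n i, w \in ends i -> (0 < n)%N -> P (brauer_scal c * brauer_turn w n i)) ->
  forall x, P x.
Proof.
move=> P0 PD Pe Pt z; rewrite -[z]quot_pi_repr.
elim/path_alg_ind: (repr z) => [|x y Px Py|c p]; first by rewrite quot_pi0.
  by rewrite quot_piD; apply: PD.
rewrite scalE -/(path_class p).
have [->|->|[w [n [wp n0 ->]]]] := path_turn p; last exact: Pt.
  by rewrite path_class_trivial.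
by rewrite mulr0.
Qed.

End BrauerAlgebra.

(* All that is used about the algebra: [turn w n i] is the path of length n
   starting at i on the cycle at w. *)
Record brauer_calculus (G : brauer_tree) (K : fieldType) (A : pzRingType)
    (e : bedge G -> A) := BrauerCalculus {
  scal : K -> A;
  turn : bvert G -> nat -> bedge G -> A;
  scal0 : scal 0 = 0;
  scal1 : scal 1 = 1;
  scalD : forall c d, scal (c + d) = scal c + scal d;
  scalM : forall c d, scal (c * d) = scal c * scal d;
  scalC : forall c x, x * scal c = scal c * x;
  idemM : forall i j, e i * e j = if i == j then e i else 0;
  turnD : forall w m n i, turn w (m + n) i = turn w m i * turn w n (turnv w m i);
  turn_src : forall w n i, w \in ends i -> (0 < n)%N -> e i * turn w n i = turn w n i;
  turn_tgt : forall w n i, w \in ends i -> (0 < n)%N ->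
    turn w n i * e (turnv w n i) = turn w n i;
  turn_mul0 : forall u w m n i j, u != w -> u \in ends i -> w \in ends j ->
    (0 < m)%N -> (0 < n)%N -> turn u m i * turn w n j = 0;
  turn_full : forall u w i, u \in ends i -> w \in ends i ->
    turn u (size (cyc u)) i = turn w (size (cyc w)) i;
  turn_gt : forall w n i, w \in ends i -> (size (cyc w) < n)%N -> turn w n i = 0;
  full_turn_neq0 : forall w i, w \in ends i -> turn w (size (cyc w)) i <> 0;
  calculus_span : forall P : A -> Prop,
    P 0 -> (forall x y, P x -> P y -> P (x + y)) ->
    (forall c i, P (scal c * e i)) ->
    (forall c w n i, w \in ends i -> (0 < n)%N -> P (scal c * turn w n i)) ->
    forall x, P x }.

Definition brauer_algP (G : brauer_tree) (K : fieldType) :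
  brauer_calculus K (@idem G K) :=
  BrauerCalculus (@brauer_scal0 G K) (@brauer_scal1 G K) (@brauer_scalD G K)
    (@brauer_scalM G K) (@brauer_scalC G K) (@brauer_idemM G K) (@brauer_turnD G K)
    (@brauer_turn_src G K) (@brauer_turn_tgt G K) (@brauer_turn_mul0 G K)
    (@brauer_turn_full G K) (@brauer_turn_gt G K) (@brauer_full_turn_neq0 G K)
    (@brauer_span G K).

(** * Homomorphisms between indecomposable projectives *)

Section HomSpaces.
Variables (G : brauer_tree) (K : fieldType) (A : pzRingType) (e : bedge G -> A).
Variable B : brauer_calculus K e.
Implicit Types (u v w : bvert G) (i j k : bedge G).

Local Notation turn := (turn B).
Local Notation scal := (scal B).

Lemma scalK c (x : A) : c != 0 -> scal c^-1 * (scal c * x) = x.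
Proof. by move=> c0; rewrite mulrA -scalM mulVf // scal1 mul1r. Qed.

(** The shortest path from [i] to [j] on the cycle at [w], meant for [i != j]: for [i = j] it is a
    turn of length 0, which need not be [e i]. *)
Definition cpath w i j : A := turn w (cdist w i j) i.
Definition soc w i : A := turn w (size (cyc w)) i.

Lemma soc_indep u w i : u \in ends i -> w \in ends i -> soc u i = soc w i.
Proof. exact: turn_full. Qed.

Lemma soc_neq0 w i : w \in ends i -> soc w i <> 0.
Proof. exact: full_turn_neq0. Qed.

Lemma idem_soc w i : w \in ends i -> e i * soc w i = soc w i.
Proof. by move=> wi; rewrite turn_src // (size_cyc_gt0 wi). Qed.

Lemma soc_idem w i : w \in ends i -> soc w i * e i = soc w i.
Proof.
move=> wi; rewrite -[in e i](turnv_size wi) turn_tgt // (size_cyc_gt0 wi) //.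
Qed.

Lemma idem_neq0 i : e i <> 0.
Proof.
have [w wi] : exists w, w \in ends i.
  by apply/card_gt0P; rewrite ends_card.
by move=> e0; apply: (soc_neq0 wi); rewrite -(idem_soc wi) e0 mul0r.
Qed.

Section Path.
Variables (w : bvert G) (i j : bedge G).
Hypotheses (wi : w \in ends i) (wj : w \in ends j) (ij : i != j).

Lemma idem_cpath : e i * cpath w i j = cpath w i j.
Proof. by rewrite turn_src // cdist_gt0. Qed.

Lemma cpath_idem : cpath w i j * e j = cpath w i j.
Proof. by rewrite -[in e j](turnv_cdist wi wj) turn_tgt // cdist_gt0. Qed.

Lemma cpathM k : w \in ends k -> (cdist w i j + cdist w j k = cdist w i k)%N ->
  cpath w i j * cpath w j k = cpath w i k.
Proof.
by move=> wk E; rewrite /cpath -E turnD; congr (_ * turn _ _ _); rewrite turnv_cdist.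
Qed.

Lemma cpathM_gt k : w \in ends k ->
  (size (cyc w) < cdist w i j + cdist w j k)%N -> cpath w i j * cpath w j k = 0.
Proof.
move=> wk lt; rewrite -(turn_gt B wi lt) turnD; congr (_ * turn _ _ _).
by rewrite turnv_cdist.
Qed.

Lemma cpath_cycle : cpath w i j * cpath w j i = soc w i.
Proof.
have E := cdist_return wi wj ij.
by rewrite /soc -E turnD; congr (_ * turn _ _ _); rewrite turnv_cdist.
Qed.

Lemma cpath_neq0 : cpath w i j <> 0.
Proof. by move=> p0; apply: (soc_neq0 wi); rewrite -cpath_cycle p0 mul0r. Qed.

Lemma soc_cpath : soc w i * cpath w i j = 0.
Proof.
rewrite -[X in _ * turn _ _ X](turnv_size wi) -turnD turn_gt //.
by rewrite -[ltnLHS]addn0 ltn_add2l cdist_gt0.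
Qed.

Lemma cpath_soc : cpath w i j * soc w j = 0.
Proof.
rewrite -[X in _ * turn _ _ X](turnv_cdist wi wj) -turnD turn_gt //.
by rewrite -[ltnLHS]add0n ltn_add2r cdist_gt0.
Qed.

End Path.

Lemma soc_soc w i : w \in ends i -> soc w i * soc w i = 0.
Proof.
move=> wi; rewrite -[X in _ * turn _ _ X](turnv_size wi) -turnD turn_gt //.
by rewrite -[ltnLHS]addn0 ltn_add2l (size_cyc_gt0 wi).
Qed.

Lemma cpath_change u w i j k : u != w -> u \in ends i -> w \in ends j ->
  i != j -> j != k -> cpath u i j * cpath w j k = 0.
Proof. by move=> uw ui wj ij jk; apply: turn_mul0; rewrite ?cdist_gt0. Qed.

(** A turn that survives starts at [i] and ends at [j], and then its length decides: it is [cpath]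
    below a full turn, [soc] at exactly one, and zero beyond. *)
Lemma turn_span w n i0 i j : w \in ends i0 -> (0 < n)%N ->
  [\/ e i * turn w n i0 * e j = 0,
      i = j /\ exists2 v, v \in ends i & e i * turn w n i0 * e j = soc v i |
      i != j /\ exists v, [/\ v \in ends i, v \in ends j &
                               e i * turn w n i0 * e j = cpath v i j]].
Proof.
move=> wp n0.
have : e i * turn w n i0 * e j =
    if (i == i0) && (turnv w n i0 == j) then turn w n i0 else 0.
  rewrite -(turn_src B wp n0) -(turn_tgt B wp n0) !mulrA (idemM B).
  case: eqP => [->|_]; last by rewrite !mul0r.
  by rewrite -!mulrA (idemM B); case: eqP => //; rewrite !mulr0.
move: (_ * e j) => a ->; case: eqP => [->|_]; last exact: Or31.
case: eqP => [tj|_] /=; last exact: Or31.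
have [lt|gt|En] := ltngtP n (size (cyc w)).
- apply: Or33; have En : cdist w i0 j = n by rewrite -tj cdist_turnv.
  split; first by rewrite -(cdist_gt0 w) En.
  by exists w; rewrite /cpath En -tj turnv_end.
- by apply: Or31; rewrite turn_gt.
apply: Or32; subst n; rewrite turnv_size // in tj.
by split=> //; exists w.
Qed.

Lemma scal_conj c x y z : x * (scal c * y) * z = scal c * (x * y * z).
Proof. by rewrite !mulrA scalC. Qed.

(** Distinct edges share at most one vertex, so only the cycle at [w] carries paths from [i] to [j],
    and only the shortest of these is nonzero. *)
Lemma span_cpath w i j a : w \in ends i -> w \in ends j -> i != j ->
  exists c, e i * a * e j = scal c * cpath w i j.
Proof.
move=> wi wj ij; elim/(@calculus_span G K A e B): a => [|a b [c ea] [d eb]|c k|c v n k vk n0].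
- by exists 0; rewrite scal0 mulr0 !mul0r.
- by exists (c + d); rewrite scalD mulrDr !mulrDl ea eb.
- exists 0; rewrite scal_conj !(idemM B) scal0 mul0r; case: eqP => [ik|_]; last by rewrite mul0r mulr0.
  by rewrite (idemM B) (negbTE ij) mulr0.
rewrite scal_conj.
have [->|[ij' _]|[_ [u [ui uj ->]]]] := turn_span i j vk n0.
- by exists 0; rewrite scal0 mulr0 mul0r.
- by rewrite ij' eqxx in ij.
by exists c; rewrite (common_end ij ui wi uj wj).
Qed.

Lemma span_disjoint i j a : (forall w, w \in ends i -> w \notin ends j) ->
  e i * a * e j = 0.
Proof.
move=> dis; have ij : i != j.
  have [w wi] : exists w, w \in ends i by apply/card_gt0P; rewrite ends_card.
  by apply/eqP => ij; have := dis w wi; rewrite -ij wi.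
elim/(@calculus_span G K A e B): a => [|a b ea eb|c k|c v n k vk n0].
- by rewrite mulr0 mul0r.
- by rewrite mulrDr mulrDl ea eb addr0.
- rewrite scal_conj !(idemM B); case: eqP => [ik|_]; last by rewrite mul0r mulr0.
  by rewrite (idemM B) (negbTE ij) mulr0.
rewrite scal_conj.
have [->|[ij' _]|[_ [u [ui uj _]]]] := turn_span i j vk n0.
- by rewrite mulr0.
- by rewrite ij' eqxx in ij.
by have := dis u ui; rewrite uj.
Qed.

Lemma span_self w i a : w \in ends i ->
  exists c d, e i * a * e i = scal c * e i + scal d * soc w i.
Proof.
move=> wi; elim/(@calculus_span G K A e B): a => [|a b [c [d ea]] [c' [d' eb]]|c k|c v n k vk n0].
- by exists 0, 0; rewrite !scal0 mulr0 !mul0r addr0.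
- by exists (c + c'), (d + d'); rewrite !scalD mulrDr !mulrDl ea eb addrACA.
- rewrite scal_conj !(idemM B); case: eqP => [_|_]; last first.
    by exists 0, 0; rewrite !scal0 !mul0r mulr0 addr0.
  by exists c, 0; rewrite (idemM B) eqxx scal0 mul0r addr0.
rewrite scal_conj.
have [->|[_ [u ui ->]]|[ii _]] := turn_span i i vk n0.
- by exists 0, 0; rewrite !scal0 mulr0 !mul0r addr0.
- by exists 0, c; rewrite scal0 mul0r add0r (soc_indep ui wi).
by rewrite eqxx in ii.
Qed.

(** The first factor is a multiple of a path on the cycle at [w], whereas the second, if nonzero,
    runs along the other cycle through [j], as [w] is not an end of [k]. *)
Lemma mul_leave w i j k a b : w \in ends i -> w \in ends j -> w \notin ends k ->
  i != j -> e i * a * e j * (e j * b * e k) = 0.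
Proof.
move=> wi wj wk ij; have [c ->] := span_cpath a wi wj ij.
have jk : j != k by apply: contraNneq wk => <-.
have [/existsP[v /andP[vj vk]]|nov] := boolP [exists v, (v \in ends j) && (v \in ends k)].
  have [d ->] := span_cpath b vj vk jk.
  have wv : w != v by apply: contraNneq wk => ->.
  by rewrite mulrA -(mulrA _ _ (scal d)) scalC !mulrA -mulrA (cpath_change wv) // mulr0.
rewrite (span_disjoint b) ?mulr0 // => v vj; apply: contraNN nov => vk.
by apply/existsP; exists v; rewrite vj.
Qed.

Lemma mul_enter w i j k a b : w \notin ends i -> w \in ends j -> w \in ends k ->
  j != k -> e i * a * e j * (e j * b * e k) = 0.
Proof.
move=> wi wj wk jk; have [d ->] := span_cpath b wj wk jk.
have ij : i != j by apply: contraNneq wi => ->.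
have [/existsP[v /andP[vi vj]]|nov] := boolP [exists v, (v \in ends i) && (v \in ends j)].
  have [c ->] := span_cpath a vi vj ij.
  have vw : v != w by apply: contraNneq wi => <-.
  by rewrite mulrA -(mulrA _ _ (scal d)) scalC !mulrA -mulrA (cpath_change vw) // mulr0.
rewrite (span_disjoint a) ?mul0r // => v vi; apply: contraNN nov => vj.
by apply/existsP; exists v; rewrite vi.
Qed.

End HomSpaces.

(** * Splitting minimal presentations *)

Section LinearSums.
Variables (R : pzRingType) (T : finType) (P N : lmodType R).
Variables (I : {set T}) (F : T -> {linear P -> N}).

Definition lin_sum (x : P) : N := \sum_(i in I) F i x.

Fact lin_sum_linear : linear lin_sum.
Proof.
move=> c x y; rewrite /lin_sum scaler_sumr -big_split /=.
by apply: eq_bigr => i _; rewrite linearP.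
Qed.
HB.instance Definition _ := GRing.isLinear.Build R P N *:%R lin_sum lin_sum_linear.

End LinearSums.

Section FixedSubmodule.
Variables (R : pzRingType) (M : lmodType R) (p : {linear M -> M}).

Definition fixed_by : {pred M} := fun x => `[< p x = x >].

Fact fixed_by_submod : submod_closed fixed_by.
Proof.
split=> [|c x y /asboolP px /asboolP py]; apply/asboolP; first exact: linear0.
by rewrite linearP px py.
Qed.
HB.instance Definition _ := GRing.isSubmodClosed.Build R M fixed_by fixed_by_submod.

Definition fixed_mod := {x : M | x \in fixed_by}.
HB.instance Definition _ := [isSub of fixed_mod for @sval _ _].
HB.instance Definition _ := [Choice of fixed_mod by <:].
HB.instance Definition _ := [SubChoice_isSubLmodule of fixed_mod by <:].

Lemma fixed_modP (x : fixed_mod) : p (val x) = val x.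
Proof. by apply/asboolP; apply: (valP x). Qed.

Hypothesis pp : forall x, p (p x) = p x.

Definition fixed_proj (x : M) : fixed_mod :=
  exist _ (p x) (introT (asboolP _) (pp x)).

Fact fixed_proj_linear : linear fixed_proj.
Proof. by move=> c x y; apply: val_inj; rewrite /= linearP. Qed.
HB.instance Definition _ := GRing.isLinear.Build R M fixed_mod *:%R fixed_proj fixed_proj_linear.

End FixedSubmodule.

Section Indecomposable.
Variable R : pzRingType.

Lemma indecomposable_idempotent (M : lmodType R) (p : {linear M -> M}) :
  indecomposable M -> (forall x, p (p x) = p x) ->
  (forall x, p x = 0) \/ (forall x, p x = x).
Proof.
move=> [_ indM] pp; pose q : {linear M -> M} := idfun \- p.
have qE x : q x = x - p x by [].
have qq x : q (q x) = q x by rewrite !qE linearB pp subrr subr0.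
pose h x : (fixed_mod p * fixed_mod q)%type := (fixed_proj pp x, fixed_proj qq x).
have h_lin : linear h by move=> c x y; rewrite /h !linearP.
pose hB := GRing.isLinear.Build R M (fixed_mod p * fixed_mod q)%type *:%R h h_lin.
pose hL : {linear M -> (fixed_mod p * fixed_mod q)%type} := HB.pack h hB.
have pq0 (y : fixed_mod q) : p (val y) = 0.
  by apply: oppr_inj; apply: (addrI (val y)); rewrite -qE fixed_modP oppr0 addr0.
have : isomorphic M (fixed_mod p * fixed_mod q)%type.
  exists hL; exists (fun u => val u.1 + val u.2) => [x|[x y]] /=; first by rewrite addrC subrK.
  congr pair; apply: val_inj; rewrite /= linearD fixed_modP pq0 addr0 //.
  by rewrite addrAC subrr add0r.
move=> /indM[z|z]; [left|right] => x.
  by have := congr1 val (z (fixed_proj pp x)).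
by have /eqP := congr1 val (z (fixed_proj qq x)); rewrite /= subr_eq0 => /eqP.
Qed.

Section Presentation.
Variables (P0 P1 M : lmodType R) (f : {linear P0 -> P1}) (g : {linear P1 -> M}).
Hypothesis presM : min_proj_presentation f g.

Lemma presentation_gf x : g (f x) = 0.
Proof. by case: presM => _ _ _ ex _; apply/ex; exists x. Qed.

(** Since [g] kills the image of [p1], following [1 - p1] by [g] still reaches the whole image of
    [g]; essentiality makes [1 - p1] surjective, so the idempotent [p1] is zero. The same argument
    with [f] then kills [p0]. *)
Lemma idempotent_kill (p0 : {linear P0 -> P0}) (p1 : {linear P1 -> P1}) :
  (forall x, p0 (p0 x) = p0 x) -> (forall x, p1 (p1 x) = p1 x) ->
  (forall x, f (p0 x) = p1 (f x)) -> (forall y, g (p1 y) = 0) ->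
  (forall x, p0 x = 0) /\ (forall y, p1 y = 0).
Proof.
move=> pp0 pp1 fp gp; case: presM => _ _ [_ essg] _ essf.
have p1_0 y : p1 y = 0.
  have [y'|y' <-] := essg _ (idfun \- p1) _ y; last by rewrite linearB /= pp1 subrr.
  by exists y'; rewrite linearB /= gp subr0.
split=> // x; have [x'|x' <-] := essf _ (idfun \- p0) _ x; last by rewrite linearB /= pp0 subrr.
by exists x'; rewrite linearB /= fp p1_0 subr0.
Qed.

(** The pair induces an idempotent endomorphism of the cokernel [M], which is zero or the identity;
    accordingly [idempotent_kill] applies to the pair or to its complement. *)
Lemma presentation_idempotent (p0 : {linear P0 -> P0}) (p1 : {linear P1 -> P1}) :
  indecomposable M ->
  (forall x, p0 (p0 x) = p0 x) -> (forall x, p1 (p1 x) = p1 x) ->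
  (forall x, f (p0 x) = p1 (f x)) ->
  ((forall x, p0 x = 0) /\ (forall y, p1 y = 0)) \/
  ((forall x, p0 x = x) /\ (forall y, p1 y = y)).
Proof.
move=> indM pp0 pp1 fp; have [_ _ [sg _] ex _] := presM.
have gp y y' : g y = g y' -> g (p1 y) = g (p1 y').
  move=> /eqP; rewrite -subr_eq0 -linearB => /eqP/ex[x fx]; apply/eqP.
  by rewrite -subr_eq0 -!linearB /= -fx -fp presentation_gf.
(* A section of [g] as a map of sets; [gp] makes [eps] independent of its choice, whence
   linearity. *)
pose s m := projT1 (cid (sg m)); have sK m : g (s m) = m := projT2 (cid (sg m)).
pose eps m := g (p1 (s m)).
have epsE y : eps (g y) = g (p1 y) by apply: gp; rewrite sK.
have eps_lin : linear eps.
  by move=> c m m'; rewrite -{1}[m]sK -{1}[m']sK -linearP epsE !linearP.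
pose epsB := GRing.isLinear.Build R M M *:%R eps eps_lin.
pose epsL : {linear M -> M} := HB.pack eps epsB.
have [m|eps0|eps1] := @indecomposable_idempotent M epsL indM _.
- by rewrite /= -[m]sK !epsE pp1.
- by left; apply: idempotent_kill => // y; rewrite -epsE; apply: eps0.
right; have [||x|y|h0 h1] := @idempotent_kill (idfun \- p0) (idfun \- p1).
- by move=> x; rewrite /= linearB pp0 subrr subr0.
- by move=> x; rewrite /= linearB pp1 subrr subr0.
- by rewrite /= linearB fp.
- rewrite /= linearB; have -> : g (p1 y) = g y by rewrite -epsE; apply: eps1.
  exact: subrr.
by split=> [x|y]; apply/eqP; rewrite eq_sym -subr_eq0; apply/eqP; [apply: h0|apply: h1].
Qed.

End Presentation.
End Indecomposable.

Section Decompositions.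
Variables (R : pzRingType) (T : finType) (U : T -> lmodType R).

Lemma dprj_ext (P : lmodType R) (I : {set T}) (D : dsum_decomp U P I) (x y : P) :
  (forall i, i \in I -> dprj D i x = dprj D i y) -> x = y.
Proof.
by move=> xy; rewrite -(dinj_prj D x) -(dinj_prj D y); apply: eq_bigr => i /xy ->.
Qed.

Lemma dprj_dinj (P : lmodType R) (I : {set T}) (D : dsum_decomp U P I) i x (X : {set T}) :
  i \in I -> X \subset I -> dprj D i (\sum_(j in X) dinj D j (dprj D j x)) =
  if i \in X then dprj D i x else 0.
Proof.
move=> iI /subsetP XI; rewrite linear_sum /=; case: ifPn => iX.
  rewrite (bigD1 i) //= dprj_inj // big1 ?addr0 // => j /andP[jX ji].
  by rewrite dprj_inj0 // XI.
rewrite big1 // => j jX; rewrite dprj_inj0 //; first exact: XI.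
by apply: contraNneq iX => <-.
Qed.

Section Conjugate.
Variables (P : lmodType R) (I : {set T}) (D : dsum_decomp U P I).
Variables (h h' : {linear P -> P}) (hK : cancel h h') (h'K : cancel h' h).

Definition conj_decomp : dsum_decomp U P I.
Proof.
refine (@DsumDecomp R T U P I (fun i => h \o dinj D i) (fun i => dprj D i \o h') _ _ _).
- by move=> i x iI; rewrite /= hK dprj_inj.
- by move=> i j x iI jI ij; rewrite /= hK dprj_inj0.
- by move=> x; rewrite /= -linear_sum /= dinj_prj h'K.
Defined.

End Conjugate.

Section Split.
Variables (P0 P1 M : lmodType R) (f : {linear P0 -> P1}) (g : {linear P1 -> M}).
Hypotheses (presM : min_proj_presentation f g) (indM : indecomposable M).
Hypothesis U_neq0 : forall i, exists a : U i, a <> 0.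
Variables (I J : {set T}) (D0 : dsum_decomp U P0 I) (D1 : dsum_decomp U P1 J).

(** The projections onto the summands indexed by [X] commute with [f] because no entry of [f]
    crosses the border of [X], so [presentation_idempotent] applies to them. *)
Lemma presentation_connected (X : {set T}) :
  (forall i j, i \in I -> j \in J -> (i \in X) != (j \in X) ->
     forall a, dprj D1 j (f (dinj D0 i a)) = 0) ->
  (forall i, i \in I :|: J -> i \notin X) \/ (I :|: J \subset X).
Proof.
move=> noX.
pose p0 : {linear P0 -> P0} := lin_sum (I :&: X) (fun i => dinj D0 i \o dprj D0 i).
pose p1 : {linear P1 -> P1} := lin_sum (J :&: X) (fun i => dinj D1 i \o dprj D1 i).
have p0E i x : i \in I -> dprj D0 i (p0 x) = if i \in X then dprj D0 i x else 0.
  by move=> iI; rewrite [LHS]dprj_dinj ?subsetIl // inE iI.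
have p1E i x : i \in J -> dprj D1 i (p1 x) = if i \in X then dprj D1 i x else 0.
  by move=> iI; rewrite [LHS]dprj_dinj ?subsetIl // inE iI.
have fp x : f (p0 x) = p1 (f x).
  apply: (dprj_ext (D := D1)) => j jJ; rewrite p1E //.
  have -> : dprj D1 j (f x) = \sum_(i in I) dprj D1 j (f (dinj D0 i (dprj D0 i x))).
    by rewrite -!linear_sum /= dinj_prj.
  rewrite -[p0 x](dinj_prj D0) !linear_sum /=; case: ifPn => jX.
    apply: eq_bigr => i iI; rewrite p0E //; case: ifPn => // iX.
    by rewrite !linear0 noX // (negbTE iX) jX.
  rewrite big1 // => i iI; rewrite p0E //; case: ifPn => iX; last by rewrite !linear0.
  by rewrite noX // iX (negbTE jX).
have [||[z0 z1]|[u0 u1]] := presentation_idempotent presM (p0 := p0) (p1 := p1) indM _ _ fp.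
- by move=> x; apply: (dprj_ext (D := D0)) => i iI; rewrite !p0E //; case: (i \in X).
- by move=> x; apply: (dprj_ext (D := D1)) => i iI; rewrite !p1E //; case: (i \in X).
- left=> i; have [a a0] := U_neq0 i; rewrite inE => iIJ; apply/negP => iX; apply: a0.
  case/orP: iIJ => iS.
    by have := p0E i (dinj D0 i a) iS; rewrite z0 linear0 iX dprj_inj // => <-.
  by have := p1E i (dinj D1 i a) iS; rewrite z1 linear0 iX dprj_inj // => <-.
right; apply/subsetP => i; have [a a0] := U_neq0 i.
rewrite inE => iIJ; apply/negPn/negP => iX; apply: a0.
case/orP: iIJ => iS.
  by have := p0E i (dinj D0 i a) iS; rewrite u0 (negbTE iX) dprj_inj.
by have := p1E i (dinj D1 i a) iS; rewrite u1 (negbTE iX) dprj_inj.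
Qed.

End Split.
End Decompositions.

(** * Matrix entries of a presentation *)

Section LeftIdeals.
Variables (R : pzRingType) (T : finType) (e : T -> R).
Hypothesis ee : forall i, e i * e i = e i.

Definition lideal (i : T) : lmodType R := left_ideal (e i).

Lemma mem_lideal i (a : R) : a * e i \in in_left_ideal (e i).
Proof. by apply/asboolP; exists a. Qed.

Definition lideal_of i (a : R) : lideal i := exist _ (a * e i) (mem_lideal i a).

Definition lval i (a : lideal i) : R := val a.

Lemma lval_of i a : lval (lideal_of i a) = a * e i.
Proof. by []. Qed.

Lemma lval_inj i : injective (@lval i).
Proof. exact: val_inj. Qed.

Lemma lval0 i : lval (0 : lideal i) = 0.
Proof. by []. Qed.

Lemma lvalD i (a b : lideal i) : lval (a + b) = lval a + lval b.
Proof. by []. Qed.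

Lemma lvalB i (a b : lideal i) : lval (a - b) = lval a - lval b.
Proof. by []. Qed.

Lemma lvalZ i c (a : lideal i) : lval (c *: a) = c * lval a.
Proof. by []. Qed.

Lemma lval_sum i (I : Type) (s : seq I) (p : pred I) (F : I -> lideal i) :
  lval (\sum_(k <- s | p k) F k) = \sum_(k <- s | p k) lval (F k).
Proof. exact: (big_morph (@lval i)). Qed.

Definition gen i : lideal i := lideal_of i 1.

Lemma lval_gen i : lval (gen i) = e i.
Proof. exact: mul1r. Qed.

Lemma lideal_idem i (a : lideal i) : lval a * e i = lval a.
Proof. by have /asboolP[b] := valP a; rewrite -/(lval a) => ->; rewrite -mulrA ee. Qed.

Lemma lideal_genE i (a : lideal i) : a = lval a *: gen i.
Proof. by apply: lval_inj; rewrite lvalZ lval_gen lideal_idem. Qed.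

Lemma linear_gen i (N : lmodType R) (h : {linear lideal i -> N}) a :
  h a = lval a *: h (gen i).
Proof. by rewrite {1}[a]lideal_genE linearZ. Qed.

Lemma linear_gen_idem i j (h : {linear lideal i -> lideal j}) :
  e i * lval (h (gen i)) * e j = lval (h (gen i)).
Proof. by rewrite -mulrA lideal_idem -lvalZ -lval_gen -linear_gen. Qed.

Section RightMul.
Variables (i j : T) (b : R).

Definition rmul (a : lideal i) : lideal j := lideal_of j (lval a * b).

Lemma lval_rmul a : lval (rmul a) = lval a * (b * e j).
Proof. by rewrite mulrA. Qed.

Fact rmul_linear : linear rmul.
Proof.
move=> c x y; apply: lval_inj.
by rewrite lvalD lvalZ !lval_rmul lvalD lvalZ mulrDl -(mulrA c).
Qed.
HB.instance Definition _ := GRing.isLinear.Build R (lideal i) (lideal j) *:%R rmul rmul_linear.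

End RightMul.

Section Entries.
Variables (P0 P1 : lmodType R) (f : {linear P0 -> P1}) (I J : {set T}).

(** The component [R e_i -> R e_j] of [f] is right multiplication by this element of [e_i R e_j]. *)
Definition entry (D0 : dsum_decomp lideal P0 I) (D1 : dsum_decomp lideal P1 J) (i j : T) : R :=
  lval (dprj D1 j (f (dinj D0 i (gen i)))).

Section Fixed.
Variables (D0 : dsum_decomp lideal P0 I) (D1 : dsum_decomp lideal P1 J).

Lemma entryE i j a : lval (dprj D1 j (f (dinj D0 i a))) = lval a * entry D0 D1 i j.
Proof.
by have := linear_gen (dprj D1 j \o f \o dinj D0 i) a => /= ->.
Qed.

Lemma entry_idem i j : e i * entry D0 D1 i j * e j = entry D0 D1 i j.
Proof. exact: (linear_gen_idem (dprj D1 j \o f \o dinj D0 i)). Qed.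

Lemma entry_src i j : e i * entry D0 D1 i j = entry D0 D1 i j.
Proof. by rewrite -entry_idem !mulrA ee. Qed.

Lemma entry_sum j x : lval (dprj D1 j (f x)) = \sum_(i in I) lval (dprj D0 i x) * entry D0 D1 i j.
Proof.
rewrite -{1}[x](dinj_prj D0) !linear_sum /= lval_sum.
by apply: eq_bigr => i _; rewrite entryE.
Qed.

Lemma entry0P i j : (forall a, dprj D1 j (f (dinj D0 i a)) = 0) <-> entry D0 D1 i j = 0.
Proof.
split=> [h|E a]; first by rewrite /entry h.
by apply: lval_inj; rewrite entryE E mulr0.
Qed.

(* Base change clearing column j by row i and row i by column j. *)
Lemma pivot_entries (i j : T) (b c : T -> R) : i \in I -> j \in J ->
  (forall k, e k * b k * e i = b k) -> (forall l, e j * c l * e l = c l) ->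
  b i = 0 -> c j = 0 ->
  exists (D0' : dsum_decomp lideal P0 I) (D1' : dsum_decomp lideal P1 J),
    forall k l, k \in I -> l \in J -> entry D0' D1' k l =
      entry D0 D1 k l - b k * entry D0 D1 i l
      - (entry D0 D1 k j - b k * entry D0 D1 i j) * c l.
Proof.
move=> iI jJ eb ec bi cj.
(* [n0] and [n1] have square zero because [b i = 0] and [c j = 0], so [1 - n0] and [1 - n1] are
   automorphisms with inverses [1 + n0] and [1 + n1]; the new decompositions are transported along
   these. *)
pose n0 : {linear P0 -> P0} := lin_sum I (fun k => dinj D0 i \o rmul i (b k) \o dprj D0 k).
pose n1 : {linear P1 -> P1} := lin_sum J (fun l => dinj D1 l \o rmul l (c l) \o dprj D1 j).
have n0_dinj k a : k \in I -> n0 (dinj D0 k a) = dinj D0 i (rmul i (b k) a).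
  move=> kI; rewrite /= /lin_sum (bigD1 k) //= dprj_inj // big1 ?addr0 // => l /andP[lI lk].
  by rewrite dprj_inj0 // 1?eq_sym // !linear0.
have rmul0 k l (a : lideal k) : rmul l 0 a = 0.
  by apply: lval_inj; rewrite lval_rmul mul0r mulr0.
have n00 x : n0 (n0 x) = 0.
  rewrite [X in n0 X]/= /lin_sum linear_sum big1 // => k kI.
  by rewrite n0_dinj // bi rmul0 linear0.
have n1_dprj l y : l \in J -> dprj D1 l (n1 y) = rmul l (c l) (dprj D1 j y).
  move=> lJ; rewrite /= /lin_sum linear_sum (bigD1 l) //= dprj_inj // big1 ?addr0 // => k /andP[kJ kl].
  by rewrite dprj_inj0.
have n11 y : n1 (n1 y) = 0.
  apply: (dprj_ext (D := D1)) => l lJ.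
  by rewrite n1_dprj // n1_dprj // cj rmul0 !linear0.
pose s0 : {linear P0 -> P0} := idfun \- n0.
pose t0 : {linear P0 -> P0} := idfun \+ n0.
pose s1 : {linear P1 -> P1} := idfun \- n1.
pose t1 : {linear P1 -> P1} := idfun \+ n1.
have st0 : cancel s0 t0.
  by move=> x; rewrite /s0 /t0 /= linearB n00 subr0 subrK.
have ts0 : cancel t0 s0.
  by move=> x; rewrite /s0 /t0 /= linearD n00 addr0 addrK.
have st1 : cancel s1 t1.
  by move=> x; rewrite /s1 /t1 /= linearB n11 subr0 subrK.
have ts1 : cancel t1 s1.
  by move=> x; rewrite /s1 /t1 /= linearD n11 addr0 addrK.
exists (conj_decomp D0 st0 ts0), (conj_decomp D1 ts1 st1) => k l kI lJ.
have fs0 m : lval (dprj D1 m (f (s0 (dinj D0 k (gen k))))) =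
    entry D0 D1 k m - b k * entry D0 D1 i m.
  have -> : s0 (dinj D0 k (gen k)) = dinj D0 k (gen k) - n0 (dinj D0 k (gen k)) by [].
  rewrite n0_dinj // (linearB f) (linearB (dprj D1 m)) lvalB !entryE lval_rmul lval_gen.
  by rewrite mulrA eb -{1}[entry D0 D1 k m]entry_idem !mulrA ee entry_idem.
transitivity (lval (dprj D1 l (s1 (f (s0 (dinj D0 k (gen k))))))); first by [].
have -> y : s1 y = y - n1 y by [].
rewrite (linearB (dprj D1 l)) n1_dprj // lvalB lval_rmul !fs0.
by rewrite -[c l]ec -!mulrA ee.
Qed.

End Fixed.
End Entries.
End LeftIdeals.

(** * The shape of the presentation *)

Section Presentation.
Variables (G : brauer_tree) (K : fieldType) (A : pzRingType) (e : bedge G -> A).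
Variable B : brauer_calculus K e.
Implicit Types (u v w : bvert G) (i j k l x : bedge G).

Local Notation U := (lideal e).
Local Notation scal := (scal B).
Local Notation soc := (soc B).
Local Notation cpath := (cpath B).

Lemma idem_sq i : e i * e i = e i.
Proof. by rewrite (idemM B) eqxx. Qed.

Lemma lideal_neq0 i : exists a : U i, a <> 0.
Proof.
exists (gen e i) => /(congr1 (@lval _ _ _ _)); rewrite lval_gen.
exact: (idem_neq0 B).
Qed.

Lemma end_exists i : exists w, w \in ends i.
Proof. by apply/card_gt0P; rewrite ends_card. Qed.

Lemma hom_soc w i j a : w \in ends j -> i != j -> e i * a * e j * soc w j = 0.
Proof.
move=> wj ij.
have [/existsP[v /andP[vi vj]]|nov] := boolP [exists v, (v \in ends i) && (v \in ends j)].
  have [c ->] := span_cpath B a vi vj ij.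
  by rewrite (soc_indep B wj vj) -mulrA cpath_soc ?mulr0.
rewrite (span_disjoint B) ?mul0r // => v vi; apply: contraNN nov => vj.
by apply/existsP; exists v; rewrite vi.
Qed.

Lemma soc_hom w i j a : w \in ends i -> i != j -> soc w i * (e i * a * e j) = 0.
Proof.
move=> wi ij.
have [/existsP[v /andP[vi vj]]|nov] := boolP [exists v, (v \in ends i) && (v \in ends j)].
  have [c ->] := span_cpath B a vi vj ij.
  by rewrite (soc_indep B wi vi) mulrA scalC -mulrA soc_cpath ?mulr0.
rewrite (span_disjoint B) ?mulr0 // => v vi; apply: contraNN nov => vj.
by apply/existsP; exists v; rewrite vi.
Qed.

Variables (M P0 P1 : lmodType A) (f : {linear P0 -> P1}) (g : {linear P1 -> M}).
Hypotheses (presM : min_proj_presentation f g) (indM : indecomposable M).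
Variables (I J : {set bedge G}).
Variables (D0 : dsum_decomp U P0 I) (D1 : dsum_decomp U P1 J).

Local Notation E := (entry f D0 D1).

Lemma entry_diag w i : i \in I -> i \in J -> w \in ends i ->
  exists d, E i i = scal d * soc w i.
Proof.
move=> iI iJ wi; have := span_self B (E i i) wi.
rewrite (entry_idem idem_sq) => -[c [d Eii]]; exists d; rewrite Eii.
have [->|c0] := eqVneq c 0; first by rewrite scal0 mul0r add0r.
exfalso.
(* The inverse of [c e_i + d s], where [s] is the socle element, whose square is zero. *)
pose r := scal c^-1 * e i - scal (c^-1 * d * c^-1) * soc w i.
have rE : r * E i i = e i.
  rewrite Eii /r mulrBl !mulrDr -!(mulrA (scal _)).
  rewrite ![e i * (scal _ * _)]mulrA ![soc w i * (scal _ * _)]mulrA !scalC.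
  rewrite -!(mulrA (scal _)) idem_sq (idem_soc B) // (soc_idem B) // (soc_soc B) //.
  rewrite !mulr0 addr0 !mulrA -!scalM mulVf // scal1 mul1r.
  by rewrite -(mulrA (_ * d)) mulVf // mulr1 addrK.
have [_ _ [_ essg] _ _] := presM.
have [y|y hy] := essg _ (idfun \- (dinj D1 i \o dprj D1 i)) _ (dinj D1 i (gen e i)).
  (* [z] is chosen so that [f z] and [y] have the same [i]-th coordinate; [y - f z] then represents
     the same element of [M] without using the [i]-th summand. *)
  pose z := dinj D0 i (lideal_of e i (lval (dprj D1 i y) * r)).
  exists (y - f z); have yz : dprj D1 i (y - f z) = 0.
    apply: lval_inj; rewrite linearB lvalB (entryE idem_sq) lval_of.
    rewrite -mulrA (entry_src idem_sq) -mulrA rE lideal_idem ?subrr //.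
    exact: idem_sq.
  by rewrite linearB /= yz linear0 linear0 subr0 linearB (presentation_gf presM) subr0.
have := congr1 (dprj D1 i) hy; rewrite linearB /= !dprj_inj // subrr.
move/esym/(congr1 (@lval _ _ _ _)); rewrite lval_gen; exact: (idem_neq0 B).
Qed.

(** This is [Hom(T, T[-1]) = 0]: such a [u] is a chain map concentrated in degree 1, and for [T] in
    degrees 0 and 1 there are no nonzero homotopies from [T] to [T[-1]]. *)
Hypothesis no_backward : forall u : {linear P1 -> P0},
  (forall z, u (f z) = 0) -> (forall y, f (u y) = 0) -> forall y, u y = 0.

(** For [u], the multiplication by the socle element from the [i]-th summand of [P1] to that of
    [P0], both composites with [f] vanish: off-diagonal entries kill the socle element, and the
    diagonal entry is a multiple of it by [entry_diag]. *)
Lemma indices_disjoint i : i \in I -> i \notin J.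
Proof.
move=> iI; apply/negP => iJ; have [w wi] := end_exists i.
have [d Eii] := entry_diag iI iJ wi.
pose u : {linear P1 -> P0} := dinj D0 i \o rmul i (soc w i) \o dprj D1 i.
have uE y : u y = dinj D0 i (rmul i (soc w i) (dprj D1 i y)) by [].
have u0 : (forall z, u (f z) = 0) -> (forall y, f (u y) = 0) ->
    dinj D0 i (rmul i (soc w i) (gen e i)) = 0.
  by move=> uf fu; have := no_backward uf fu (dinj D1 i (gen e i)); rewrite uE dprj_inj.
apply: (soc_neq0 (B := B) wi).
have : rmul i (soc w i) (gen e i) = 0.
  rewrite -(dprj_inj D0 (rmul i (soc w i) (gen e i)) iI) u0 ?linear0 // => [x|y].
    rewrite uE; suff -> : rmul i (soc w i) (dprj D1 i (f x)) = 0 by rewrite linear0.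
    apply: lval_inj; rewrite lval_rmul (entry_sum idem_sq f D0) (soc_idem B) //.
    rewrite mulr_suml big1 // => k kI; rewrite -mulrA.
    have [->|ki] := eqVneq k i; first by rewrite Eii -mulrA (soc_soc B) // !mulr0.
    by rewrite -[E k i](entry_idem idem_sq) hom_soc // mulr0.
  apply: (dprj_ext (D := D1)) => j jJ; rewrite linear0 uE.
  apply: lval_inj; rewrite (entryE idem_sq) lval_rmul (soc_idem B) // -mulrA.
  have [<-|ij] := eqVneq i j; first by rewrite Eii (mulrA (soc w i)) scalC -(mulrA (scal d)) (soc_soc B) // !mulr0.
  by rewrite -[E i j](entry_idem idem_sq) soc_hom // mulr0.
by move/(congr1 (@lval _ _ _ _)); rewrite lval_rmul lval_gen (soc_idem B) // (idem_soc B).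
Qed.

Lemma indices_neq i j : i \in I -> j \in J -> i != j.
Proof. by move=> /indices_disjoint iJ jJ; apply: contraNneq iJ => ->. Qed.

Lemma entry_share i j : E i j <> 0 -> exists2 w, w \in ends i & w \in ends j.
Proof.
move=> Eij; have [/existsP[v /andP[vi vj]]|nov] := boolP [exists v, (v \in ends i) && (v \in ends j)].
  by exists v.
case: Eij; rewrite -(entry_idem idem_sq) (span_disjoint B) // => v vi.
by apply: contraNN nov => vj; apply/existsP; exists v; rewrite vi.
Qed.

Lemma entry_cpath w i j : i \in I -> j \in J -> w \in ends i -> w \in ends j ->
  exists c, E i j = scal c * cpath w i j.
Proof.
move=> iI jJ wi wj; rewrite -(entry_idem idem_sq).
by apply: span_cpath => //; apply: indices_neq.
Qed.

Lemma connected_indices (X : {set bedge G}) :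
  (forall i j, i \in I -> j \in J -> (i \in X) != (j \in X) -> E i j = 0) ->
  forall i, i \in I :|: J -> i \in X -> I :|: J \subset X.
Proof.
move=> noX i iS iX.
have [||//] := presentation_connected presM indM lideal_neq0 (D0 := D0) (D1 := D1) (X := X).
  by move=> k l kI lJ kl; apply/(entry0P idem_sq); apply: noX.
by move=> /(_ i iS); rewrite iX.
Qed.

Lemma connected_pivot (X : {set bedge G}) i j b c : i \in I -> j \in J ->
  (forall k, e k * b k * e i = b k) -> (forall l, e j * c l * e l = c l) ->
  b i = 0 -> c j = 0 -> i \in X ->
  (forall k l, k \in I -> l \in J -> (k \in X) != (l \in X) ->
     E k l - b k * E i l - (E k j - b k * E i j) * c l = 0) ->
  I :|: J \subset X.
Proof.
move=> iI jJ eb ec bi cj iX noX.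
have [D0' [D1' DE]] := pivot_entries idem_sq f D0 D1 iI jJ eb ec bi cj.
have [||//] := presentation_connected presM indM lideal_neq0 (D0 := D0') (D1 := D1') (X := X).
  by move=> k l kI lJ kl; apply/(entry0P idem_sq); rewrite DE //; apply: noX.
by move=> /(_ i); rewrite inE iI iX => /(_ isT).
Qed.

Definition linked_at w (p : bedge G * bedge G) : bool :=
  [&& p.1 \in I, p.2 \in J, w \in ends p.1, w \in ends p.2 & `[< E p.1 p.2 <> 0 >]].

Lemma shortest_link w p0 : linked_at w p0 ->
  exists i j, [/\ linked_at w (i, j),
    forall k, k \in I -> w \in ends k -> k != i ->
      exists b, e k * b * e i = b /\ b * E i j = E k j &
    forall l, l \in J -> w \in ends l -> l != j ->
      exists c, e j * c * e l = c /\ E i j * c = E i l].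
Proof.
move=> /(@arg_minnP _ _ (linked_at w) (fun p => cdist w p.1 p.2)).
set p := arg_min _ _ _; case=> -[i j] lnk minij; exists i, j.
have /and5P[/= iI jJ wi wj /asboolP Eij] := lnk.
have ij := indices_neq iI jJ.
have [c0 Eij0] := entry_cpath iI jJ wi wj.
have c0n : c0 != 0 by apply/eqP => c00; apply: Eij; rewrite Eij0 c00 scal0 mul0r.
have min k l : linked_at w (k, l) -> (cdist w i j <= cdist w k l)%N by move/minij.
split=> // [k kI wk ki|l lJ wl lj].
  have [c Ekj] := entry_cpath kI jJ wk wj.
  have [c00|cn] := eqVneq c 0.
    by exists 0; rewrite mulr0 !mul0r Ekj c00 scal0 mul0r.
  have kj := indices_neq kI jJ.
  have le : (cdist w i j <= cdist w k j)%N.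
    apply: min; apply/and5P; split=> //; apply/asboolP; rewrite Ekj => E0.
    by apply: (cpath_neq0 (B := B) wk wj kj); rewrite -(scalK B (cpath w k j) cn) E0 mulr0.
  (* The path from [k] to [j] runs through [i], as it is at least as long as the one from [i];
     [c / c0] is the ratio of the coefficients of the two entries. *)
  exists (scal (c / c0) * cpath w k i); split.
    by rewrite scal_conj idem_cpath // cpath_idem.
  rewrite Ekj Eij0 -(mulrA (scal _)) (mulrA (cpath _ _ _) (scal _)) scalC -(mulrA (scal _) (cpath _ _ _)).
  rewrite mulrA -scalM divfK //; congr (_ * _); apply: cpathM => //.
  exact: cdist_closer_source.
have [c Eil] := entry_cpath iI lJ wi wl.
have [c00|cn] := eqVneq c 0.
  by exists 0; rewrite mulr0 !mul0r mulr0 Eil c00 scal0 mul0r.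
have il := indices_neq iI lJ.
have le : (cdist w i j <= cdist w i l)%N.
  apply: min; apply/and5P; split=> //; apply/asboolP; rewrite Eil => E0.
  by apply: (cpath_neq0 (B := B) wi wl il); rewrite -(scalK B (cpath w i l) cn) E0 mulr0.
exists (scal (c / c0) * cpath w j l); split.
  by rewrite scal_conj idem_cpath ?cpath_idem // eq_sym.
rewrite Eil Eij0 -(mulrA (scal _)) (mulrA (cpath _ _ _) (scal _)) scalC -(mulrA (scal _) (cpath _ _ _)).
rewrite mulrA -scalM mulrC divfK //; congr (_ * _); apply: cpathM => //.
exact: cdist_closer_target.
Qed.

(** Once the pivot has cleared the other entries of row [i] and column [j] along the cycle at [w],
    no entry joins the branches of [i] and [j] away from [w] to the rest. So these branches contain
    all indices, and in them only [i] and [j] end at [w]. *)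
Lemma pivot_indices w i j : linked_at w (i, j) ->
    (forall k, k \in I -> w \in ends k -> k != i ->
      exists b, e k * b * e i = b /\ b * E i j = E k j) ->
    (forall l, l \in J -> w \in ends l -> l != j ->
      exists c, e j * c * e l = c /\ E i j * c = E i l) ->
  forall k, k \in I :|: J -> w \in ends k -> k = i \/ k = j.
Proof.
move=> /and5P[/= iI jJ wi wj _] exb exc.
(* Outside the rows to be cleared [b] is 0, which gives [b i = 0], as the base change requires;
   likewise for [c]. *)
have /choice[b bP] k : exists b,
    if [&& k \in I, w \in ends k & k != i] then e k * b * e i = b /\ b * E i j = E k j
    else b = 0.
  have [/and3P[kI wk ki]|_] := boolP [&& k \in I, _ & _]; last by exists 0.
  exact: exb.
have /choice[c cP] l : exists c,
    if [&& l \in J, w \in ends l & l != j] then e j * c * e l = c /\ E i j * c = E i l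
    else c = 0.
  have [/and3P[lJ wl lj]|_] := boolP [&& l \in J, _ & _]; last by exists 0.
  exact: exc.
have [a ai aw] := other_end wi; have [a' aj aw'] := other_end wj.
have wa : w != a by rewrite eq_sym.
have wa' : w != a' by rewrite eq_sym.
have nI l : l \in J -> (l \in I) = false.
  by move=> lJ; apply/negP => /indices_disjoint; rewrite lJ.
pose X := branch i a :|: branch j a'.
have iX : i \in X by rewrite in_setU branch_self.
have jX : j \in X by rewrite in_setU (branch_self aj) orbT.
have Xw k : k \in X -> w \in ends k -> k = i \/ k = j.
  rewrite in_setU => kX wk; have [->|ki] := eqVneq k i; first by left.
  have [->|kj] := eqVneq k j; first by right.
  by rewrite !(negbTE (notin_branch _ _ _ wk _)) in kX.
have exitX k l u : k \in X -> l \notin X -> u \in ends k -> u \in ends l -> u = w.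
  rewrite !in_setU => kX /norP[li lj] uk ul.
  by case/orP: kX => kX; [have [] := branch_exit wi ai wa kX li uk ul
                        |have [] := branch_exit wj aj wa' kX lj uk ul].
(* A nonzero entry joins edges with a common end, and an edge of [X] meets one outside [X] only at
   [w]. *)
have E0 k l : (k \in X) != (l \in X) -> ~~ ((w \in ends k) && (w \in ends l)) -> E k l = 0.
  move=> kl nw; apply: contrapT => /entry_share[u uk ul].
  suff uw : u = w by rewrite -uw uk ul in nw.
  have [kX|kX] := boolP (k \in X).
    by apply: (exitX k l) => //; move: kl; rewrite kX; case: (l \in X).
  by apply: (exitX l k) => //; move: kl; rewrite (negbTE kX); case: (l \in X).
suff SX : I :|: J \subset X by move=> k kS wk; apply: Xw => //; apply: (subsetP SX).
apply: (@connected_pivot X i j b c) => //.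
- by move=> k; have := bP k; case: ifP => [_ []|_ ->] //; rewrite mulr0 mul0r.
- by move=> l; have := cP l; case: ifP => [_ []|_ ->] //; rewrite mulr0 mul0r.
- by have := bP i; rewrite eqxx !andbF.
- by have := cP j; rewrite eqxx !andbF.
move=> k l kI lJ kl.
have bk0 : w \notin ends k -> b k = 0 by move=> wk; have := bP k; rewrite (negbTE wk) andbF.
have cl0 : w \notin ends l -> c l = 0 by move=> wl; have := cP l; rewrite (negbTE wl) andbF.
have bi0 : b i = 0 by have := bP i; rewrite eqxx !andbF.
have cj0 : c j = 0 by have := cP j; rewrite eqxx !andbF.
have [kX|kX] := boolP (k \in X).
  have lX : l \notin X by move: kl; rewrite kX; case: (l \in X).
  have lj : l != j by apply: contraNneq lX => ->.
  have [wk|wk] := boolP (w \in ends k).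
    have ki : k = i.
      have [//|kj] := Xw k kX wk.
      by move: kI; rewrite kj nI.
    rewrite ki bi0 !mul0r !subr0.
    have [wl|wl] := boolP (w \in ends l).
      by have := cP l; rewrite lJ wl lj => -[_ ->]; rewrite subrr.
    rewrite (cl0 wl) mulr0 subr0 E0 ?(negbTE wl) ?andbF //.
    by rewrite iX (negbTE lX).
  (* Here [k] lies in [X] but off the cycle at [w], so the correction [E k j * c l] changes cycle at
     [j] and vanishes. *)
  rewrite (bk0 wk) !mul0r !subr0 E0 ?(negbTE wk) // sub0r.
  have [wl|wl] := boolP (w \in ends l); last by rewrite (cl0 wl) mulr0 oppr0.
  have := cP l; rewrite lJ wl lj => -[<- _].
  by rewrite -[E k j](entry_idem idem_sq) (mul_enter B _ _ wk wj wl) ?oppr0 // eq_sym.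
have lX : l \in X by move: kl; rewrite (negbTE kX); case: (l \in X).
have ki : k != i by apply: contraNneq kX => ->.
have [wl|wl] := boolP (w \in ends l).
  have lj : l = j.
    have [li|//] := Xw l lX wl.
    by move: iI; rewrite -li nI.
  rewrite lj cj0 mulr0 subr0.
  have [wk|wk] := boolP (w \in ends k).
    by have := bP k; rewrite kI wk ki => -[_ ->]; rewrite subrr.
  rewrite (bk0 wk) mul0r subr0 E0 ?(negbTE wk) //.
  by rewrite jX (negbTE kX).
rewrite (cl0 wl) mulr0 subr0 E0 ?(negbTE wl) ?andbF // sub0r.
have [wk|wk] := boolP (w \in ends k); last by rewrite (bk0 wk) mul0r oppr0.
have := bP k; rewrite kI wk ki => -[<- _].
by rewrite -[E i l](entry_idem idem_sq) (mul_leave B _ _ wk wi wl ki) oppr0.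
Qed.

(** The branch of [i] away from [w] meets the edges outside it only at [w]. Without links there, no
    entry crosses its border, so it contains all indices, and in it only [i] ends at [w]. *)
Lemma lone_index w i : i \in I :|: J -> w \in ends i ->
    (forall p, ~~ linked_at w p) ->
  forall k, k \in I :|: J -> w \in ends k -> k = i.
Proof.
move=> iS wi nolink.
have [a ai aw] := other_end wi; have wa : w != a by rewrite eq_sym.
have SX : I :|: J \subset branch i a.
  apply: (connected_indices _ iS); last exact: branch_self.
  move=> k l kI lJ kl; apply: contrapT => Ekl; have [u uk ul] := entry_share Ekl.
  suff uw : u = w.
    have /negP := nolink (k, l); apply; apply/and5P; split; rewrite // -?uw //.
    exact/asboolP.
  have [kX|kX] := boolP (k \in branch i a).
    have lX : l \notin branch i a by move: kl; rewrite kX; case: (l \in _).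
    by have [] := branch_exit wi ai wa kX lX uk ul.
  have lX : l \in branch i a by move: kl; rewrite (negbTE kX); case: (l \in _).
  by have [] := branch_exit wi ai wa lX kX ul uk.
move=> k kS wk; apply/eqP; apply: contraTT (subsetP SX k kS) => ki.
exact: notin_branch wi ai wa wk ki.
Qed.

Lemma cycle_indices w :
  (exists i j, linked_at w (i, j) /\
     forall k, k \in I :|: J -> w \in ends k -> k = i \/ k = j) \/
  (forall i k, i \in I :|: J -> k \in I :|: J ->
     w \in ends i -> w \in ends k -> k = i).
Proof.
have [[p lp]|nolink] := pselect (exists p, linked_at w p); [left|right].
  have [i [j [lnk exb exc]]] := shortest_link lp.
  by exists i, j; split=> //; apply: pivot_indices.
move=> i k iS kS wi wk; apply: (@lone_index w) => // p; apply/negP => lp.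
by apply: nolink; exists p.
Qed.

Lemma source_uniq w i k : i \in I -> k \in I -> w \in ends i -> w \in ends k -> k = i.
Proof.
move=> iI kI wi wk; have iS : i \in I :|: J by rewrite inE iI.
have kS : k \in I :|: J by rewrite inE kI.
have [[i' [j' [/and5P[/= _ jJ _ _ _] all]]]|all] := cycle_indices w; last exact: all.
have nj m : m \in I -> m = j' -> m = i'.
  by move=> mI mj; have := indices_disjoint mI; rewrite mj jJ.
have -> : i = i' by have [|/nj->] := all i iS wi.
by have [|/nj->] := all k kS wk.
Qed.

Lemma sink_uniq w j l : j \in J -> l \in J -> w \in ends j -> w \in ends l -> l = j.
Proof.
move=> jJ lJ wj wl; have jS : j \in I :|: J by rewrite inE jJ orbT.
have lS : l \in I :|: J by rewrite inE lJ orbT.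
have [[i' [j' [/and5P[/= iI _ _ _ _] all]]]|all] := cycle_indices w; last exact: all.
have ni m : m \in J -> m = i' -> m = j'.
  by move=> mJ mi; have := indices_disjoint iI; rewrite -mi mJ.
have -> : j = j' by have [/ni->|] := all j jS wj.
by have [/ni->|] := all l lS wl.
Qed.

Lemma link_neq0 w i j : i \in I -> j \in J -> w \in ends i -> w \in ends j -> E i j <> 0.
Proof.
move=> iI jJ wi wj.
have [[i' [j' [/and5P[/= iI' jJ' wi' wj' /asboolP Eij] _]]]|all] := cycle_indices w.
  by rewrite -(source_uniq iI iI' wi wi') -(sink_uniq jJ jJ' wj wj').
by have := indices_neq iI jJ; rewrite (all i j) ?inE ?iI ?jJ ?orbT ?eqxx.
Qed.

Lemma end_source_hom v i x : i \in I -> v \in ends i -> v \in ends x ->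
    (forall j, j \in J -> v \notin ends j) ->
  exists phi : {linear P0 -> U x},
    ~ exists h : {linear P1 -> U x}, forall z, phi z = h (f z).
Proof.
move=> iI vi vx noJ.
(* The case [i = x] is set apart because [cpath] has length 0 there; [phi] is then the projection to
   that summand. *)
pose b := if i == x then e i else cpath v i x.
exists (rmul x b \o dprj D0 i) => -[h hE].
pose H j := lval (h (dinj D1 j (gen e j))).
have HE j : e j * H j * e x = H j.
  exact: (linear_gen_idem idem_sq (h \o dinj D1 j)).
have : b = \sum_(j in J) E i j * H j.
  have := hE (dinj D0 i (gen e i)); rewrite /= dprj_inj // => /(congr1 (@lval _ _ _ _)).
  rewrite lval_rmul lval_gen => bE.
  have -> : b = e i * (b * e x).
    rewrite /b; case: eqP => [<-|/eqP ix]; first by rewrite !idem_sq.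
    by rewrite cpath_idem // idem_cpath.
  rewrite bE -[f _ in LHS](dinj_prj D1) linear_sum lval_sum.
  apply: eq_bigr => j jJ; rewrite /H /entry.
  have := linear_gen idem_sq (h \o dinj D1 j) (dprj D1 j (f (dinj D0 i (gen e i)))).
  by move=> /= ->.
rewrite /b; have [ix|ix] := eqVneq i x.
  (* Each [H j], having [j != i], is killed by the socle element on the right, while [e i] is
     not. *)
  move=> /(congr1 (fun y => y * soc v i)); rewrite idem_soc // mulr_suml big1.
    exact: (soc_neq0 (B := B) vi).
  move=> j jJ; rewrite -mulrA -[H j]HE -ix hom_soc ?mulr0 //.
  by rewrite eq_sym indices_neq.
rewrite big1; first exact: (cpath_neq0 (B := B) vi vx ix).
move=> j jJ; rewrite -[H j]HE -[E i j](entry_idem idem_sq).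
have [/existsP[u /andP[ui uj]]|nov] := boolP [exists u, (u \in ends i) && (u \in ends j)]; last first.
  rewrite (span_disjoint B) ?mul0r // => u ui; apply: contraNN nov => uj.
  by apply/existsP; exists u; rewrite ui.
apply: (mul_leave B _ _ ui uj); last exact: indices_neq.
apply/negP => ux; have := noJ j jJ.
by rewrite (common_end ix vi ui vx ux) uj.
Qed.

(** * Factoring maps from [P0] to [A e_x] through [f] *)

Section Factor.
Variable x : bedge G.
Hypothesis lift : forall psi : {linear U x -> P1}, exists z, psi (gen e x) = f z.

(** The lifting property as a linear system for a row vector [y], obtained by lifting the map from
    [A e_x] into the [j]-th summand of [P1] given by [b]. *)
Lemma lift_coord j b : j \in J -> exists y : bedge G -> A,
  (forall k, e x * y k * e k = y k) /\
  forall l, l \in J -> \sum_(k in I) y k * E k l = if l == j then e x * b * e j else 0.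
Proof.
move=> jJ; have [z zE] := lift (dinj D1 j \o rmul j b).
exists (fun k => e x * lval (dprj D0 k z)); split=> [k|l lJ].
  by rewrite mulrA idem_sq -mulrA lideal_idem //; apply: idem_sq.
have := congr1 (fun t => e x * lval (dprj D1 l t)) zE; rewrite /= (entry_sum idem_sq f D0).
rewrite mulr_sumr => sE; under eq_bigr do rewrite -mulrA.
rewrite -sE; case: eqP => [->|/eqP lj]; last first.
  by rewrite dprj_inj0 // 1?eq_sym // lval0 mulr0.
by rewrite dprj_inj // lval_rmul lval_gen !mulrA idem_sq.
Qed.

(** Lifting the inclusion of the summand [x] would write [e x] as a sum of products through sources
    different from [x]; the socle element kills these but not [e x]. *)
Lemma lift_notin_sinks : x \notin J.
Proof.
apply/negP => xJ; have [v vx] := end_exists x.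
have [y [ey /(_ x xJ)]] := lift_coord 1 xJ; rewrite eqxx mulr1 idem_sq.
move=> /(congr1 (fun t => t * soc v x)); rewrite idem_soc // mulr_suml big1 => [/esym|k kI].
  exact: (soc_neq0 (B := B) vx).
rewrite -mulrA -[E k x](entry_idem idem_sq) hom_soc ?mulr0 //.
exact: indices_neq.
Qed.

Hypothesis no_end : forall i u, i \in I -> u \in ends i -> u \in ends x ->
  exists2 j, j \in J & u \in ends j.

(** Otherwise both cycles through [x] carry sinks, [j] and [l]. Lift the path from [x] to [j]: no
    other source meets [x], and the socle part of [y x] has no effect, so a scalar [c] has to make
    [c E x j] nonzero and [c E x l] zero, although [E x l] is nonzero. *)
Lemma lift_notin_sources : x \notin I.
Proof.
apply/negP => xI; have [u ux] := end_exists x; have [v vx vu] := other_end ux.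
have [j jJ uj] := no_end xI ux ux; have [l lJ vl] := no_end xI vx vx.
have xj := indices_neq xI jJ; have xl := indices_neq xI lJ.
have lj : l != j.
  apply: contraNneq vu => lj; apply/eqP; apply: (common_end xj) => //.
  by rewrite -lj.
have [y [ey sy]] := lift_coord (cpath u x j) jJ.
have sumE m : \sum_(k in I) y k * E k m = y x * E x m.
  rewrite (bigD1 x) //= big1 ?addr0 // => k /andP[kI kx].
  rewrite -ey (span_disjoint B) ?mul0r // => w wx; apply: contraNN kx => wk.
  exact/eqP/(source_uniq xI kI wx wk).
have [c [d yx]] := span_self B (y x) ux; rewrite ey in yx.
have yE m : m \in J -> y x * E x m = scal c * E x m.
  move=> mJ; rewrite yx mulrDl -!mulrA (entry_src idem_sq).
  by rewrite -[E x m](entry_idem idem_sq) soc_hom ?mulr0 ?addr0 //; apply: indices_neq.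
have := sy j jJ; rewrite eqxx sumE yE // idem_cpath // cpath_idem // => Exj.
have := sy l lJ; rewrite (negbTE lj) sumE yE // => Exl.
have [c0|cn] := eqVneq c 0.
  by apply: (cpath_neq0 (B := B) ux uj xj); rewrite -Exj c0 scal0 mul0r.
by apply: (link_neq0 xI lJ vx vl); rewrite -(scalK B (E x l) cn) Exl mulr0.
Qed.

Lemma factor_source (phi : {linear P0 -> U x}) i : i \in I ->
  exists h : {linear P1 -> U x}, forall k, k \in I ->
    lval (h (f (dinj D0 k (gen e k)))) =
    if k == i then lval (phi (dinj D0 i (gen e i))) else 0.
Proof.
move=> iI; have ix : i != x by apply: contraNneq lift_notin_sources => <-.
have := linear_gen_idem idem_sq (phi \o dinj D0 i); rewrite /= => phiE.
have [/existsP[w /andP[wi wx]]|nov] := boolP [exists w, (w \in ends i) && (w \in ends x)]; last first.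
  exists \0 => k _; rewrite /= lval0 -phiE (span_disjoint B) ?if_same // => v vi.
  by apply: contraNN nov => vx; apply/existsP; exists v; rewrite vi.
have [j jJ wj] := no_end iI wi wx.
have jx : j != x by apply: contraNneq lift_notin_sinks => <-.
have ij := indices_neq iI jJ.
have nw k : k \in I -> k != i -> w \notin ends k.
  by move=> kI; apply: contraNN => wk; apply/eqP; apply: source_uniq wi wk.
have [c Eij] := entry_cpath iI jJ wi wj.
have cn : c != 0.
  by apply/eqP => c0; apply: (link_neq0 iI jJ wi wj); rewrite Eij c0 scal0 mul0r.
have [d phid] := span_cpath B (lval (phi (dinj D0 i (gen e i)))) wi wx ix.
rewrite phiE in phid.
have [split_ix|wrap] := cdistD wi wj wx.
  pose b := scal (d / c) * cpath w j x.
  have be : b * e x = b by rewrite -mulrA cpath_idem.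
  exists (rmul x b \o dprj D1 j) => k kI; rewrite /= lval_rmul be -/(E k j).
  case: eqP => [->|/eqP ki].
    rewrite phid Eij /b -(mulrA (scal _)) (mulrA (cpath _ _ _) (scal _)) scalC.
    by rewrite -(mulrA (scal _) (cpath _ _ _)) mulrA -scalM mulrC divfK // cpathM.
  (* No source but [i] lies on the cycle at [w], so [E k j] followed by the path to [x] changes
     cycle. *)
  have {1}-> : b = e j * b * e x by rewrite /b scal_conj idem_cpath // cpath_idem.
  by rewrite -[E k j](entry_idem idem_sq) (mul_enter B _ _ (nw k kI ki) wj wx jx).
(* Now [x] lies strictly between [i] and [j]. In a lift of the path from [x] to [j], the term
   through [i] is longer than a full turn, and any other source reaches [j] only along a cycle
   missing [x]; so the sum would be zero. *)
exfalso; have xj : x != j by rewrite eq_sym.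
have xi : x != i by rewrite eq_sym.
have [y [ey /(_ j jJ)]] := lift_coord (cpath w x j) jJ.
rewrite eqxx idem_cpath // cpath_idem // big1 => [/esym|k kI].
  exact: (cpath_neq0 (B := B) wx wj xj).
have [->|ki] := eqVneq k i.
  have [a] := span_cpath B (y i) wx wi xi; rewrite ey => ->.
  rewrite Eij mulrA -(mulrA (scal a)) scalC -!mulrA cpathM_gt ?mulr0 //.
  exact: cdist_wrap.
rewrite -ey -[E k j](entry_idem idem_sq).
have [/existsP[v /andP[vk vj]]|nov] := boolP [exists v, (v \in ends k) && (v \in ends j)].
  apply: (mul_enter B _ _ _ vk vj); last exact: indices_neq.
  by apply: contraNN (nw k kI ki) => vx; rewrite (common_end jx wj vj wx vx).
rewrite (span_disjoint B (E k j)) ?mulr0 // => v vk; apply: contraNN nov => vj.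
by apply/existsP; exists v; rewrite vk.
Qed.

Lemma factor_through (phi : {linear P0 -> U x}) :
  exists h : {linear P1 -> U x}, forall z, phi z = h (f z).
Proof.
have /choice[h hE] i : exists h : {linear P1 -> U x}, i \in I ->
    forall k, k \in I -> lval (h (f (dinj D0 k (gen e k)))) =
      if k == i then lval (phi (dinj D0 i (gen e i))) else 0.
  have [iI|iI] := boolP (i \in I); last by exists \0.
  by have [h hE] := factor_source phi iI; exists h.
exists (lin_sum I h) => z; rewrite -(dinj_prj D0 z) !linear_sum.
apply: eq_bigr => k kI.
rewrite [LHS](linear_gen idem_sq (phi \o dinj D0 k)).
rewrite [RHS](linear_gen idem_sq (lin_sum I h \o f \o dinj D0 k)).
congr (_ *: _); apply: lval_inj; rewrite /= /lin_sum lval_sum (bigD1 k) //=.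
rewrite hE // eqxx big1 ?addr0 // => i /andP[iI ik].
by rewrite hE // eq_sym (negbTE ik).
Qed.

End Factor.

End Presentation.

(** * The diagram *)

Lemma mem_left_arc (T : eqType) (c : seq T) x y :
  uniq c -> x \in c -> y \in c -> x != y -> x \in arc c x y.
Proof. by move=> Uc xc yc xy; case: (rot_to_arc Uc xc yc xy) => i p q <- _ _; apply: mem_head. Qed.

(** In the rotation of [c] that starts with [x], only the last item is followed by [x], and it lies
    outside the arc, at [y] or later. Hence a marked path never returns to its source. *)
Lemma arc_next_neq (T : eqType) (c : seq T) x y z :
  uniq c -> x \in c -> y \in c -> x != y -> z \in arc c x y -> next c z != x.
Proof.
move=> Uc xc yc xy; case: (rot_to_arc Uc xc yc xy) => i p q <- _ rc zp.
have Ur : uniq (x :: p ++ y :: q) by rewrite -rc rot_uniq.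
have : fcycle (next c) (x :: p ++ y :: q) by rewrite -rc rot_cycle cycle_next.
rewrite /= rcons_path last_cat /= => /andP[_ /eqP nx]; apply/eqP; rewrite -nx.
move/(can_inj (prev_next Uc)) => zl.
move: Ur; rewrite -cat_cons cat_uniq => /and3P[_ /hasPn/(_ z)].
by rewrite zl mem_last -zl => /(_ isT); rewrite zp.
Qed.

Section Diagram.
Variables (G : brauer_tree) (K : fieldType).
Variables (P0 P1 : lmodType (brauer_alg G K)) (f : {linear P0 -> P1}).
Variables (I J : {set bedge G}).
Variables (D0 : dsum_decomp (@proj_at G K) P0 I) (D1 : dsum_decomp (@proj_at G K) P1 J).
Local Notation linked := (linked f D0 D1).
Local Notation diag_arrows := (diag_arrows f D0 D1).

Hypothesis disj : forall i, i \in I -> i \notin J.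
Hypothesis share : forall i j, linked i j -> exists2 w, w \in ends i & w \in ends j.
Hypothesis source1 : forall w i k,
  i \in I -> k \in I -> w \in ends i -> w \in ends k -> k = i.
Hypothesis connected : forall X : {set bedge G},
  (forall i j, linked i j -> (i \in X) = (j \in X)) ->
  forall i, i \in I :|: J -> i \in X -> I :|: J \subset X.
Hypothesis J_neq0 : exists j, j \in J.

Lemma linked_idx i j : linked i j -> i \in I /\ j \in J.
Proof. by case/and3P. Qed.

Lemma diag_arrowsP a : a \in diag_arrows ->
  exists i j, [/\ linked i j, arr_vert a \in ends i, arr_vert a \in ends j &
                  arr_src a \in arc (cyc (arr_vert a)) i j].
Proof.
rewrite inE => /existsP[i /existsP[j]]; rewrite !inE => /and4P[? ? ? ?].
by exists i, j.
Qed.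

Variables (i : bedge G) (u : bvert G).
Hypotheses (iI : i \in I) (ui : u \in ends i) (noJ : forall j, j \in J -> u \notin ends j).

Lemma source_linked : exists j, linked i j.
Proof.
apply: contrapT => nolink; have iS : i \in I :|: J by rewrite inE iI.
have [j jJ] := J_neq0; have /subsetP SX : I :|: J \subset [set i].
  apply: (connected _ iS); last exact: set11.
  move=> k l kl; have [kI lJ] := linked_idx kl; rewrite !inE.
  have -> : (l == i) = false by apply/eqP => li; have := disj iI; rewrite -li lJ.
  by apply/eqP => ki; apply: nolink; exists l; rewrite -ki.
have /set1P ji : j \in [set i] by apply: SX; rewrite inE jJ orbT.
by have := disj iI; rewrite -ji jJ.
Qed.

Lemma end_source_arrow a : a \in diag_arrows -> arr_vert a != u.
Proof.
move=> /diag_arrowsP[k [l [kl _ ul _]]]; apply: contraTneq ul => ->.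
by apply: noJ; case: (linked_idx kl).
Qed.

(** All marked arrows at [i] lie on its second cycle, at [w]. The one leaving [i] is marked because
    [i] has a link there; one arriving at [i] would belong to an arc starting at [i] itself, by
    [source1], which [arc_next_neq] forbids. *)
Lemma end_source_degree : diag_degree f D0 D1 i = 1%N.
Proof.
have [j ij] := source_linked; have [_ jJ] := linked_idx ij.
have [w wi wj] := share ij; have nij : i != j by apply: contraNneq (disj iI) => ->.
have uw : u != w by apply: contraTneq wj => <-; apply: noJ.
have vw (a : barrow G) : a \in diag_arrows -> arr_vert a \in ends i -> arr_vert a = w.
  move=> aD va; have := end_source_arrow aD.
  by have [->|//] := ends_case ui wi uw va; rewrite eqxx.
pose a0 : barrow G := exist _ (w, i) wi.
rewrite /diag_degree; set A1 := [set _ in _ | _]; set A2 := [set _ in _ | _].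
have -> : A1 = [set a0].
  apply/setP => a; rewrite !inE; apply/andP/eqP => [[aD /eqP sa]|->].
    have va : arr_vert a = w by apply: vw; rewrite ?inE // -sa arr_srcP.
    by apply: val_inj; rewrite /= -va -sa; apply: surjective_pairing.
  split; last by rewrite eqxx.
  apply/existsP; exists i; apply/existsP; exists j; rewrite ij !inE wi wj /=.
  by apply: mem_left_arc; rewrite ?cyc_uniq ?mem_cyc.
have -> : A2 = set0; last by rewrite cards1 cards0.
apply/setP => a; rewrite !inE; apply/negP => /andP[aD /eqP ta].
have va : arr_vert a = w by apply: vw; rewrite ?inE // -ta arr_tgtP.
have [|k [l [kl vk vl sa]]] := @diag_arrowsP a; first by rewrite inE.
have [kI lJ] := linked_idx kl.
have ki : k = i by apply: (source1 iI kI wi); rewrite -va.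
have il : i != l by apply: contraNneq (disj iI) => ->.
move: ta; apply/eqP; rewrite ki in sa; apply: arc_next_neq sa; rewrite ?cyc_uniq ?mem_cyc //.
by rewrite -ki.
Qed.

(** If a vertex [m] of a marked path had [u] as an end without being [i], it would be neither a
    source nor a sink. Links cross the border of the branch of [m] away from [u] only at [m] itself,
    so this branch would contain all indices, while [i] lies on the side of [u]. *)
Lemma end_source_verts k : k \in diag_verts f D0 D1 -> u \in ends k -> k = i.
Proof.
have onI m : m \in I -> u \in ends m -> m = i by move=> mI um; apply: source1 ui um.
have onA a m : a \in diag_arrows -> arr_vert a \in ends m -> u \in ends m -> m = i.
  move=> aD vm um; apply: contrapT => mi; have va := end_source_arrow aD.
  have [k' [l [kl vk vl _]]] := diag_arrowsP aD; have [kI lJ] := linked_idx kl.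
  have uv : u != arr_vert a by rewrite eq_sym.
  have mS : m \notin I :|: J.
    by rewrite inE; apply/norP; split; apply/negP; [move/onI/(_ um)|move/noJ; rewrite um].
  have /subsetP SX : I :|: J \subset branch m (arr_vert a).
    apply: (@connected _ _ k'); first last.
    - by apply/branchP; exists (arr_vert a).
    - by rewrite inE kI.
    move=> s t st; have [sI tJ] := linked_idx st; have [y ys yt] := share st.
    apply/idP/idP => X1; apply/negPn/negP => X2; move: mS.
      have [<- _] := branch_exit um vm uv X1 X2 ys yt; by rewrite inE sI.
    by have [<- _] := branch_exit um vm uv X1 X2 yt ys; rewrite inE tJ orbT.
  have := SX i; rewrite inE iI => /(_ isT); apply/negP.
  by apply: (notin_branch um vm uv ui); apply/eqP => im; apply: mi.
rewrite /diag_verts; case/setUP => [/setUP[/setUP[|/noJ]|]|].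
- exact: onI.
- by move/negbTE=> ->.
- by case/imsetP=> a aD -> ; apply: (onA a) => //; apply: arr_srcP.
- by case/imsetP=> a aD -> ; apply: (onA a) => //; apply: arr_tgtP.
Qed.

End Diagram.

(** * Complexes *)

Definition pair_inl (R : pzRingType) (U V : lmodType R) (x : U) : U * V := (x, 0).

Fact pair_inl_linear (R : pzRingType) (U V : lmodType R) : linear (@pair_inl R U V).
Proof. by move=> a x y; rewrite /pair_inl; congr pair; rewrite /= scaler0 addr0. Qed.
HB.instance Definition _ (R : pzRingType) (U V : lmodType R) :=
  GRing.isLinear.Build R U (U * V)%type *:%R (@pair_inl R U V) (@pair_inl_linear R U V).

Section Complexes.
Variable R : pzRingType.
Implicit Types X Y : complex R.

Section Concentrated.
Variables (X Y : complex R) (k : int) (c : {linear X k -> Y k}).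
Hypotheses (dc : forall m x, cdiff Y k m (c x) = 0) (cd : forall n x, c (cdiff X n k x) = 0).

Definition at_degree n : {linear X n -> Y n} :=
  match n =P k with
  | ReflectT nk => eq_rect_r (fun n => {linear X n -> Y n}) c nk
  | ReflectF _ => \0
  end.

Lemma at_degreeE : at_degree k = c.
Proof. by rewrite /at_degree; case: eqP => // kk; rewrite (eq_axiomK kk). Qed.

Lemma at_degree_neq n x : n != k -> at_degree n x = 0.
Proof. by rewrite /at_degree; case: eqP. Qed.

Fact at_degree_comm n m x : cdiff Y n m (at_degree n x) = at_degree m (cdiff X n m x).
Proof.
have [nk|nk] := eqVneq n k; have [mk|mk] := eqVneq m k.
- by subst n m; rewrite !at_degreeE dc cd.
- by subst n; rewrite at_degreeE dc at_degree_neq.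
- by subst m; rewrite at_degreeE cd at_degree_neq // linear0.
- by rewrite !at_degree_neq // linear0.
Qed.

Definition concentrated : cmap X Y := Cmap at_degree_comm.

End Concentrated.

Definition cmap_id X : cmap X X :=
  @Cmap R X X (fun n => idfun) (fun n m x => erefl).

Lemma cmap_id_quasi_iso X : quasi_iso (cmap_id X).
Proof.
split=> [n x _ [y xy]|n y dy]; first by exists y.
by exists y, 0; rewrite linear0 addr0.
Qed.

Lemma perfect_in_Db X : perfect X -> in_Db X.
Proof. by case=> bX pX; split=> // n; case: (pX n). Qed.

Lemma partial_tilting_resolution X i (phi : cmap X (shift X i)) :
  partial_tilting X -> i != 0 ->
  exists (W : complex R) (t : cmap W X),
    quasi_iso t /\ @null_homotopic R W (shift X i) (fun n x => phi n (t n x)).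
Proof.
move=> [pX tX] i0.
have [W [t [_ qt nt]]] := tX i i0 X (cmap_id X) phi (perfect_in_Db pX) (cmap_id_quasi_iso X).
by exists W, t.
Qed.

Lemma zero_modE (a : zero_mod R) : a = 0.
Proof. exact: thinmx0. Qed.

Section TwoTermStalk.
Variables (P0 P1 P : lmodType R) (f : {linear P0 -> P1}).
Local Notation T := (two_term f).
Local Notation S := (stalk P).
Local Notation X := (dsum T S).

Lemma two_term_out n m (x : T n) : n != 0 -> cdiff T n m x = 0.
Proof. by case: n x => [[|[|n]]|n] x; case: m => [[|[|m]]|m]. Qed.

Lemma two_term_in n m (x : T n) : m != 1 -> cdiff T n m x = 0.
Proof. by case: n x => [[|[|n]]|n] x; case: m => [[|[|m]]|m]. Qed.

Lemma dsum_out n m (x : X n) : n != 0 -> cdiff X n m x = 0.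
Proof. by move=> n0; rewrite /= /pair_map two_term_out. Qed.

Lemma dsum_in n m (x : X n) : m != 1 -> cdiff X n m x = 0.
Proof. by move=> n0; rewrite /= /pair_map two_term_in. Qed.

Lemma dsum_ker m (x : X 0) : f x.1 = 0 -> cdiff X 0 m x = 0.
Proof.
by move=> fx; case: m => [[|[|m]]|m] //; rewrite /= /pair_map /= fx.
Qed.

Lemma shift_diff_scale i n m (x : X (n + i)) : exists s : R,
  cdiff (shift X i) n m x = s *: cdiff X (n + i) (m + i) x.
Proof.
rewrite /= /shift_diff; case: odd; first by exists (-1); rewrite /= scaleN1r.
by exists 1; rewrite scale1r.
Qed.

(** [u] gives a chain map from [X] to [X[-1]] concentrated in degree 1. Up to a boundary, [(y, 0)]
    is the image under [t] of a cycle, on which this map is a homotopy term coming from degree -1 of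
    [X], hence zero; boundaries are killed because [u] vanishes on the image of [f]. *)
Lemma hom_backward_zero (u : {linear P1 -> P0}) : partial_tilting X ->
  (forall z, u (f z) = 0) -> (forall y, f (u y) = 0) -> forall y, u y = 0.
Proof.
move=> tX uf fu y.
pose c0 : {linear (P1 * zero_mod R)%type -> (P0 * P)%type} := @pair_inl R P0 P \o u \o fst.
pose c : {linear X 1 -> shift X (-1) 1} := c0.
have dc m x : cdiff (shift X (-1)) 1 m (c x) = 0.
  have [s ->] := shift_diff_scale m (c x).
  have -> : cdiff X (1 + -1) (m + -1) (c x) = 0 by apply: (@dsum_ker _ (c x)); apply: fu.
  exact: scaler0.
have cd n x : c (cdiff X n 1 x) = 0.
  have [n0|n0] := eqVneq n 0; last by rewrite dsum_out ?linear0.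
  by subst n; rewrite /c /= uf linear0.
have [W [t [[_ qt] [h nt]]]] := partial_tilting_resolution (concentrated dc cd) tX isT.
have [|w [y' [dw yE]]] := qt 1 (y, 0); first exact: dsum_out.
have := nt 1 w; rewrite dw linear0 addr0.
have -> : concentrated dc cd 1 (t 1 w) = c (t 1 w) by rewrite /= at_degreeE.
have [s ->] := shift_diff_scale 1 (h 1 (1 - 1) w).
rewrite dsum_out // scaler0 => ct0.
have : c ((y, 0) : X 1) = 0 by rewrite yE linearD cd addr0.
by move/(congr1 fst).
Qed.

(** The same evaluation in degree 0: [(0, p)] is a cycle and there are no boundaries, so [psi p]
    equals the remaining homotopy term, which is up to sign the image under [f] of an element of
    [P0]. *)
Lemma hom_stalk_lift (psi : {linear P -> P1}) : partial_tilting X ->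
  forall p, exists z, psi p = f z.
Proof.
move=> tX p.
pose c0 : {linear (P0 * P)%type -> (P1 * zero_mod R)%type} := @pair_inl R P1 (zero_mod R) \o psi \o snd.
pose c : {linear X 0 -> shift X 1 0} := c0.
have dc m x : cdiff (shift X 1) 0 m (c x) = 0.
  by have [s ->] := shift_diff_scale m (c x); rewrite dsum_out ?scaler0.
have cd n x : c (cdiff X n 0 x) = 0 by rewrite dsum_in ?linear0.
have [W [t [[_ qt] [h nt]]]] := partial_tilting_resolution (concentrated dc cd) tX isT.
have [|w [y' [dw yE]]] := qt 0 (0, p); first by rewrite /= /pair_map /= linear0.
have := nt 0 w; rewrite dw linear0 addr0.
have -> : concentrated dc cd 0 (t 0 w) = c (t 0 w) by rewrite /= at_degreeE.
have [s ->] := shift_diff_scale 0 (h 0 (0 - 1) w).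
rewrite (dsum_out (n := 0 - 1)) // in yE.
move: yE; rewrite addr0 => <-.
pose v : P0 * P := h 0 (0 - 1) w.
move=> /(congr1 fst) E; exists (s *: v.1).
by rewrite linearZ; apply: E.
Qed.

(** The stalk is zero outside degree 0, so only the component [P0 -> P] of a chain map and the
    component [P1 -> P] of a homotopy count; every map [P0 -> P] is a chain map, as [T] has no
    differential into degree 0. *)
Lemma hom_Kb_nonzeroP : hom_Kb_nonzero T S <->
  exists phi : {linear P0 -> P}, ~ exists h : {linear P1 -> P}, forall z, phi z = h (f z).
Proof.
split=> [[F nF]|[phi nphi]].
  exists (F 0) => -[h hE]; apply: nF.
  pose hh n m : {linear T n -> S m} :=
    match n, m return {linear T n -> S m} with
    | Posz 1, Posz 0 => h
    | _, _ => \0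
    end.
  exists hh => -[[|n]|n] x; first by rewrite [LHS]hE /= add0r.
    by rewrite [LHS]zero_modE [RHS]zero_modE.
  by rewrite [LHS]zero_modE [RHS]zero_modE.
have dc m (x : T 0) : cdiff S 0 m ((phi : {linear T 0 -> S 0}) x) = 0 by [].
have cd n (x : T n) : (phi : {linear T 0 -> S 0}) (cdiff T n 0 x) = 0.
  by rewrite two_term_in ?linear0.
exists (concentrated dc cd) => -[h hE]; apply: nphi; exists (h 1 0) => z.
have := hE 0 z; have -> : concentrated dc cd 0 z = phi z by rewrite /= at_degreeE.
by move=> ->; rewrite /= add0r.
Qed.

End TwoTermStalk.
End Complexes.

(** * The criterion for nonzero maps from [T] to [P] *)

Lemma isomorphic_linear (R : pzRingType) (M N : lmodType R) : isomorphic M N ->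
  exists (a : {linear M -> N}) (b : {linear N -> M}), cancel a b /\ cancel b a.
Proof.
move=> [a [b ab ba]]; have b_lin : linear b.
  by move=> c x y; apply: (can_inj ab); rewrite linearP !ba.
pose bB := GRing.isLinear.Build R N M *:%R b b_lin.
pose bL : {linear N -> M} := HB.pack b bB.
by exists a, bL.
Qed.

Lemma linkedP (G : brauer_tree) (K : fieldType)
    (P0 P1 : lmodType (brauer_alg G K)) (f : {linear P0 -> P1}) (I J : {set bedge G})
    (D0 : dsum_decomp (@proj_at G K) P0 I) (D1 : dsum_decomp (@proj_at G K) P1 J) i j :
  linked f D0 D1 i j <-> [/\ i \in I, j \in J & entry (e := @idem G K) f D0 D1 i j <> 0].
Proof.
have E0 := entry0P (idem_sq (brauer_algP G K)) f D0 D1 i j.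
split=> [/and3P[iI jJ /asboolP[a ca]]|[iI jJ nE]].
  by split=> // /E0 c0; apply: ca; apply: c0.
apply/and3P; split=> //; apply/asboolP; apply: contrapT => na; apply: nE; apply/E0 => a.
by apply: contrapT => ca; apply: na; exists a.
Qed.

Lemma sinks_neq0 (R : pzRingType) (T : finType) (U : T -> lmodType R)
    (P0 P1 M : lmodType R) (f : {linear P0 -> P1}) (g : {linear P1 -> M}) (J : {set T}) :
  min_proj_presentation f g -> indecomposable M -> dsum_decomp U P1 J ->
  exists j, j \in J.
Proof.
move=> [_ _ [sg _] _ _] [nM _] D; apply: contrapT => J0; apply: nM => m.
have [y <-] := sg m; rewrite -(dinj_prj D y) big1 ?linear0 // => j jJ.
by case: J0; exists j.
Qed.

Theorem proposition2 (K : closedFieldType) (G : brauer_tree)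
    (M P0 P1 : lmodType (brauer_alg G K))
    (f : {linear P0 -> P1}) (g : {linear P1 -> M})
    (I J : {set bedge G})
    (D0 : dsum_decomp (@proj_at G K) P0 I) (D1 : dsum_decomp (@proj_at G K) P1 J)
    (P : lmodType (brauer_alg G K)) (x : bedge G)
    (fgM : fin_gen M) (indecM : indecomposable M) (nprojM : ~ projective M)
    (presM : min_proj_presentation f g)
    (indecP : indecomposable P) (projP : projective P)
    (PAx : isomorphic P (proj_at K x))
    (tilt : partial_tilting (dsum (two_term f) (stalk P))) :
  hom_Kb_nonzero (two_term f) (stalk P) <->
  exists (i : bedge G) (v : bvert G),
    [/\ i \in I /\ diag_degree f D0 D1 i = 1%N,
        i \in Acycle v, x \in Acycle v
      & forall k, k \in diag_verts f D0 D1 -> k \in Acycle v -> k = i].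
Proof.
pose B := brauer_algP G K.
have nb := hom_backward_zero tilt.
have [a [b [ab ba]]] := isomorphic_linear PAx.
have disj := indices_disjoint B presM D0 D1 nb.
have lift (psi : {linear proj_at K x -> P1}) : exists z, psi (gen (@idem G K) x) = f z.
  have [z zE] := hom_stalk_lift (psi \o a) tilt (b (gen (@idem G K) x)).
  by exists z; rewrite -zE /= ba.
apply: (iff_trans (hom_Kb_nonzeroP P f)); split=> [[phi nphi]|[i [v [[iI _] iv xv only]]]].
  (* Either some source shares with [x] an end [u] that carries no sink, or [factor_through]
     contradicts the choice of [phi]. *)
  have [[i [u [iI ui ux noJ]]]|noend] := pselect (exists i u, [/\ i \in I, u \in ends i,
      u \in ends x & forall j, j \in J -> u \notin ends j]); last first.
    case: nphi.
    have [|h hE] := @factor_through _ _ _ _ B _ _ _ f g presM indecM I J D0 D1 nb x lift _ (a \o phi).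
      move=> i u iI ui ux; apply: contrapT => noj; apply: noend.
      exists i, u; split=> // j jJ; apply/negP => uj; apply: noj; by exists j.
    by exists (b \o h) => z; rewrite /= -hE /= ab.
  have share i' j' : linked f D0 D1 i' j' -> exists2 w, w \in ends i' & w \in ends j'.
    by move=> /linkedP[_ _]; apply: (entry_share B).
  have source1 w i' k' := @source_uniq _ _ _ _ B _ _ _ f g presM indecM I J D0 D1 nb w i' k'.
  have conn (X : {set bedge G}) :
      (forall i j, linked f D0 D1 i j -> (i \in X) = (j \in X)) ->
      forall i, i \in I :|: J -> i \in X -> I :|: J \subset X.
    move=> noX; apply: (connected_indices B presM indecM (D0 := D0) (D1 := D1)) => k l kI lJ.
    move=> kl; apply: contrapT => Ekl; move/negP: kl; apply; apply/eqP; apply: noX.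
    exact/linkedP.
  have J0 := sinks_neq0 presM indecM D1.
  exists i, u; rewrite !inE; split=> //.
    split=> //; exact: (end_source_degree disj share source1 conn J0 iI ui noJ).
  by move=> k kD; rewrite inE; apply: (end_source_verts share source1 conn iI ui noJ).
rewrite !inE in iv xv.
(* A sink on the cycle at [v] would be a vertex of the diagram there, hence equal to the source [i],
   against [disj]. *)
have noJ j : j \in J -> v \notin ends j.
  move=> jJ; apply/negP => vj; have := disj i iI.
  by rewrite -(only j) ?jJ // ?inE ?jJ ?orbT.
have [phi nphi] := end_source_hom B presM D0 D1 nb iI iv xv noJ.
exists (b \o phi) => -[h hE]; apply: nphi; exists (a \o h) => z.
by rewrite /= -hE /= ba.
Qed.
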